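(* Suppose that an irreducible generic representation $(\pi,V)$ of $G$ satisfies $N_\pi\ge2$ and $N_\pi>n_\pi$. Then, for every $v\in V(N_\pi)$, $$Z(s,W_v)=\frac{1-q^{-2s}}{1-\dfrac{\lambda+q^2}{q^2}\,q^{-2s}}\;W_v(1),$$ where $\lambda$ is the eigenvalue of the Hecke operator $T$ on $V(N_\pi)$.
   Context: Fields: $F$ is a non-archimedean local field of characteristic zero and odd residual characteristic, with $\mathfrak{o}_F$, $\mathfrak{p}_F=\varpi\mathfrak{o}_F$, $q=\#(\mathfrak{o}_F/\mathfrak{p}_F)$. $E/F$ is the unramified quadratic extension; bar is the nontrivial element of $\mathrm{Gal}(E/F)$; $\varpi$ is a uniformizer of $E$, $|\varpi|_E=q^{-2}$. Groups: $G=\{g\in\mathrm{GL}_3(E): {}^t\overline{g}Jg=J\}$ with $J$ the antidiagonal matrix with all antidiagonal entries $1$. $U$ is the subgroup of $u(x,y)=\begin{pmatrix}1&x&y\\0&1&-\overline{x}\\0&0&1\end{pmatrix}$, $x,y\in E$, $y+\overline y+x\overline x=0$. For $a\in E^\times$, $t(a)=\mathrm{diag}(a,1,\overline a^{-1})\in G$. $K_n=\begin{pmatrix}\mathfrak{o}_E&\mathfrak{o}_E&\mathfrak{p}_E^{-n}\\\mathfrak{p}_E^n&1+\mathfrak{p}_E^n&\mathfrak{o}_E\\\mathfrak{p}_E^n&\mathfrak{p}_E^n&\mathfrak{o}_E\end{pmatrix}\cap G$ for $n\ge0$. The center $Z$ of $G$ is identified with the norm-one group $E^1\subset E^\times$;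 $Z_0=Z$, $Z_n=Z\cap(1+\mathfrak{p}_E^n)$ for $n\ge1$. Whittaker functions: fix a nontrivial additive character $\psi_E$ of $E$ with conductor $\mathfrak{o}_E$ (the largest fractional ideal on which it is trivial) and set $\psi_E(u(x,y))=\psi_E(x)$ on $U$. $(\pi,V)$ is generic if $\mathrm{Hom}_U(\pi,\psi_E)\neq\{0\}$; for irreducible generic $\pi$ this space is one-dimensional, and for a fixed nonzero $l$ in it, $W_v(g)=l(\pi(g)v)$ for $v\in V$. Conductors: $V(n)=V^{K_n}$. For irreducible generic $\pi$ some $V(n)\ne\{0\}$; $N_\pi=\min\{n\ge0:V(n)\ne\{0\}\}$ and $V(N_\pi)$ is known to be one-dimensional. With $\omega_\pi$ the central character, $n_\pi=\min\{n\ge0:\omega_\pi|_{Z_n}=1\}$. Hecke operator: with $\zeta=\mathrm{diag}(\varpi,1,\varpi^{-1})$, $Tv=\frac{1}{\mathrm{vol}(K_n)}\int_{K_n\zeta K_n}\pi(k)v\,dk$ for $v\in V(n)$. On the one-dimensional space $V(N_\pi)$, $T$ acts by a scalar $\lambda\in\mathbf{C}$. Zeta integral: $Z(s,W)=\int_{E^\times}W(t(a))|a|_E^{s-1}\,d^\times a$, with $\mathrm{vol}(\mathfrak{o}_E^\times)=1$; it converges absolutely for $\mathrm{Re}(s)$ large to a function in $\mathbf{C}(q^{-2s})$. *)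

(* Defs.v *)
From HB Require Import structures.
From mathcomp Require Import all_boot all_order all_algebra fieldext.
From mathcomp Require Import all_classical topology_structure.

Set Implicit Arguments.
Unset Strict Implicit.
Unset Printing Implicit Defensive.

Import Order.TTheory GRing.Theory Num.Theory.
Local Open Scope classical_set_scope.
Local Open Scope ring_scope.

(** * Non-archimedean local fields *)

(* A discrete valuation is given by its values [v x] at nonzero [x]; [v 0] is
   irrelevant (mathematically it is +oo), whence the disjunction. *)
Definition frac_ideal_of (F : fieldType) (v : F -> int) (n : int) : set F :=
  [set x | x = 0 \/ n <= v x].

Definition residue_classes_of (F : fieldType) (v : F -> int) : set (set F) :=
  [set [set y | frac_ideal_of v 1 (y - x)] | x in frac_ideal_of v 0].

(* A field complete for a normalized discrete valuation, with finite residue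
   field (of cardinality [residue_card]), carrying the valuation topology. *)
HB.mixin Record Field_isLocalField F of GRing.Field F & Topological F := {
  ordv : F -> int;
  residue_card : nat;
  ordvM : forall x y : F, x != 0 -> y != 0 -> ordv (x * y) = ordv x + ordv y;
  ordvD : forall x y : F, x != 0 -> y != 0 -> x + y != 0 ->
    Num.min (ordv x) (ordv y) <= ordv (x + y);
  ordv_normalized : exists2 x : F, x != 0 & ordv x = 1;
  residue_cardP : (residue_classes_of ordv #= `I_residue_card)%card;
  nbhs_ordv : forall (x : F) (A : set F),
    nbhs x A <-> exists n : int, forall y, frac_ideal_of ordv n (y - x) -> A y;
  ordv_complete : forall u : nat -> F,
    (forall n : int, exists N, forall i j, (N <= i)%N -> (N <= j)%N ->
       frac_ideal_of ordv n (u i - u j)) ->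
    exists l : F, u @ \oo --> l
}.

#[short(type="localFieldType")]
HB.structure Definition LocalField :=
  {F of Field_isLocalField F & GRing.Field F & Topological F}.

#[short(type="localFieldExtType")]
HB.structure Definition LocalFieldExt (F : fieldType) :=
  {E of LocalField E & FieldExt F E}.

Arguments residue_card : clear implicits.

(* Required only after [LocalFieldExt]: the library's
   topological modules are over numDomainTypes, so Hierarchy-Builder rejects a
   topological module over a plain field when both are in scope. *)
From mathcomp Require Import all_reals all_analysis fraction complex.

Local Open Scope complex_scope.

(* The fractional ideal p_F^n, for n in Z. *)
Definition frac_ideal (F : localFieldType) (n : int) : set F :=
  frac_ideal_of (@ordv F) n.

Definition uniformizer (F : localFieldType) (x : F) : Prop :=
  x != 0 /\ ordv x = 1.

Definition residue_char (F : localFieldType) (p : nat) : Prop :=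
  prime p /\ frac_ideal 1 (p%:R : F).

Definition norm_val (R : realType) (F : localFieldType) (x : F) : R :=
  if x == 0 then 0 else (residue_card F)%:R ^ (- ordv x).

(* Ramification index 1 and residue degree 2. *)
Definition unramified_quadratic (F : localFieldType)
    (E : localFieldExtType F) : Prop :=
  [/\ \dim {:E} = 2%N,
      forall x : F, x != 0 -> ordv (x%:A : E) = ordv x
    & residue_card E = (residue_card F ^ 2)%N].

(** * The multiplicative group of a local field *)

Definition units (E : localFieldType) := {a : E | a != 0}.

Section Units.
Variable E : localFieldType.

HB.instance Definition _ := [isSub of units E for @sval E (fun a => a != 0)].
HB.instance Definition _ := [Choice of units E by <:].

Fact units_one_subproof : (1 : E) != 0. Proof. exact: oner_neq0. Qed.
Fact units_inv_subproof (a : units E) : (val a)^-1 != 0.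
Proof. by rewrite invr_eq0 (valP a). Qed.
Fact units_mul_subproof (a b : units E) : val a * val b != 0.
Proof. by rewrite mulf_neq0 ?(valP a) ?(valP b). Qed.

Definition units_one : units E := Sub 1 units_one_subproof.
Definition units_inv a : units E := Sub (val a)^-1 (units_inv_subproof a).
Definition units_mul a b : units E := Sub (val a * val b) (units_mul_subproof a b).

Fact units_mulA : associative units_mul.
Proof. by move=> a b c; apply: val_inj; rewrite /= mulrA. Qed.
Fact units_mul1 : left_id units_one units_mul.
Proof. by move=> a; apply: val_inj; rewrite /= mul1r. Qed.
Fact units_mulr1 : right_id units_one units_mul.
Proof. by move=> a; apply: val_inj; rewrite /= mulr1. Qed.
Fact units_mulV : left_inverse units_one units_inv units_mul.
Proof. by move=> a; apply: val_inj; rewrite /= mulVf ?(valP a). Qed.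
Fact units_mulrV : right_inverse units_one units_inv units_mul.
Proof. by move=> a; apply: val_inj; rewrite /= divff ?(valP a). Qed.

HB.instance Definition _ := isGroup.Build (units E)
  units_mulA units_mul1 units_mulr1 units_mulV units_mulrV.
HB.instance Definition _ := isPointed.Build (units E) units_one.
HB.instance Definition _ :=
  Topological.copy (units E) (initial_topology (val : units E -> E)).

End Units.

(** * The unitary group in three variables *)

Definition antidiag (E : nzRingType) : 'M[E]_3 :=
  \matrix_(i, j) ((i + j)%N == 2)%:R.

Definition unitary_mx (E : fieldType) (bar : {rmorphism E -> E}) :
    pred 'M[E]_3 :=
  fun g => (map_mx bar g)^T *m antidiag E *m g == antidiag E.

Definition U3 (E : localFieldType) (bar : {rmorphism E -> E}) :=
  {g : 'M[E]_3 | unitary_mx bar g}.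

Section U3Theory.
Variables (E : localFieldType) (bar : {rmorphism E -> E}).
Local Notation G := (U3 bar).
Local Notation J := (antidiag E).

HB.instance Definition _ := [isSub of G for @sval 'M[E]_3 (unitary_mx bar)].
HB.instance Definition _ := [Choice of G by <:].

Lemma antidiag_sqr : J *m J = 1%:M.
Proof.
apply/matrixP => i j; rewrite !mxE !big_ord_recl big_ord0 !mxE.
by case: i => [[|[|[|]]] //= ?]; case: j => [[|[|[|]]] //= ?];
  rewrite /= ?mulr0 ?mul0r ?mulr1 ?addr0 ?add0r.
Qed.

Lemma unitary_mx_unit (g : 'M[E]_3) : unitary_mx bar g -> g \in unitmx.
Proof.
move=> /eqP gJ; have := congr1 (mulmx J) gJ.
rewrite antidiag_sqr !mulmxA => /mulmx1_unit[] //.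
Qed.

Fact U3_one_subproof : unitary_mx bar 1%:M.
Proof. by rewrite /unitary_mx map_mx1 trmx1 mul1mx mulmx1. Qed.
Fact U3_mul_subproof (g h : G) : unitary_mx bar (val g *m val h).
Proof.
rewrite /unitary_mx map_mxM trmx_mul -!mulmxA.
rewrite (mulmxA _ J) (mulmxA _ (val g)) (eqP (valP g)) mulmxA.
exact: valP h.
Qed.
Fact U3_inv_subproof (g : G) : unitary_mx bar (invmx (val g)).
Proof.
have gu := unitary_mx_unit (valP g).
rewrite /unitary_mx -[X in _ *m X *m _](eqP (valP g)).
rewrite !mulmxA -trmx_mul -map_mxM mulmxV // map_mx1 trmx1 mul1mx.
by rewrite -mulmxA mulmxV // mulmx1.
Qed.

Definition U3_one : G := Sub 1%:M U3_one_subproof.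
Definition U3_inv g : G := Sub (invmx (val g)) (U3_inv_subproof g).
Definition U3_mul g h : G := Sub (val g *m val h) (U3_mul_subproof g h).

Fact U3_mulA : associative U3_mul.
Proof. by move=> a b c; apply: val_inj; rewrite /= mulmxA. Qed.
Fact U3_mul1 : left_id U3_one U3_mul.
Proof. by move=> a; apply: val_inj; rewrite /= mul1mx. Qed.
Fact U3_mulr1 : right_id U3_one U3_mul.
Proof. by move=> a; apply: val_inj; rewrite /= mulmx1. Qed.
Fact U3_mulV : left_inverse U3_one U3_inv U3_mul.
Proof.
by move=> a; apply: val_inj; rewrite /= mulVmx // (unitary_mx_unit (valP a)).
Qed.
Fact U3_mulrV : right_inverse U3_one U3_inv U3_mul.
Proof.
by move=> a; apply: val_inj; rewrite /= mulmxV // (unitary_mx_unit (valP a)).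
Qed.

HB.instance Definition _ := isGroup.Build G
  U3_mulA U3_mul1 U3_mulr1 U3_mulV U3_mulrV.
HB.instance Definition _ := isPointed.Build G U3_one.
HB.instance Definition _ :=
  Topological.copy G (initial_topology (val : G -> 'M[E]_3)).

Definition mx3 (a b c d e f g h i : E) : 'M[E]_3 :=
  \matrix_(k, l)
    nth 0 (nth [::] [:: [:: a; b; c]; [:: d; e; f]; [:: g; h; i]] k) l.

Definition umx (x y : E) : 'M[E]_3 :=
  mx3 1 x y
      0 1 (- bar x)
      0 0 1.

Definition tmx (a : E) : 'M[E]_3 :=
  mx3 a 0 0
      0 1 0
      0 0 (bar a)^-1.

Lemma tmx_unitary (a : E) :
  involutive bar -> a != 0 -> unitary_mx bar (tmx a).
Proof.
move=> barK a0; apply/eqP/matrixP => i j.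
rewrite !mxE !big_ord_recl big_ord0 !mxE !big_ord_recl !big_ord0 !mxE.
case: i => [[|[|[|]]] //= ?]; case: j => [[|[|[|]]] //= ?];
  rewrite /= ?(rmorph0, rmorph1, fmorphV, barK);
  rewrite ?(mulr0, mul0r, mulr1, mul1r, addr0, add0r) //.
  by rewrite divff // fmorph_eq0.
by rewrite mulVf.
Qed.

(* [insubd] is total; its default value 1 is never met, by [tmx_unitary]. *)
Definition torus (a : units E) : G := insubd (1%g : G) (tmx (val a)).

Definition entry (g : G) (i j : nat) : E := val g (inord i) (inord j).

Definition Kn (n : nat) : set G := [set g |
  [/\ [/\ frac_ideal 0 (entry g 0 0),
          frac_ideal 0 (entry g 0 1)
        & frac_ideal (- n%:Z) (entry g 0 2)],
      [/\ frac_ideal n%:Z (entry g 1 0),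
          frac_ideal n%:Z (entry g 1 1 - 1)
        & frac_ideal 0 (entry g 1 2)]
    & [/\ frac_ideal n%:Z (entry g 2 0),
          frac_ideal n%:Z (entry g 2 1)
        & frac_ideal 0 (entry g 2 2)]]].

(* Z_n, inside the norm-one group E^1 identified with the center of G. *)
Definition center_n (n : nat) : set E :=
  [set z | z * bar z = 1 /\ ((0 < n)%N -> frac_ideal n%:Z (z - 1))].

End U3Theory.

Arguments Kn {E} bar n.

(** * Haar measures and integrals *)

Definition borel (T : topologicalType) := g_sigma_algebraType (@open T).

Section Haar.
Variables (R : realType) (T : ptopologicalType).

(* [mul] is the group law of T. *)
Definition left_haar (mul : T -> T -> T)
    (mu : {measure set (borel T) -> \bar R}) : Prop :=
  [/\ forall A : set T, compact A -> (mu A < +oo)%E,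
      forall A : set T, open A -> A !=set0 -> (0 < mu A)%E
    & forall (g : T) (A : set (borel T)), measurable A ->
        mu (mul g @` A) = mu A].

Definition complex_integrable (mu : {measure set (borel T) -> \bar R})
    (f : T -> R[i]) : Prop :=
  mu.-integrable setT (fun x : borel T => (complex.Re (f x))%:E) /\
  mu.-integrable setT (fun x : borel T => (complex.Im (f x))%:E).

Definition complex_integral (mu : {measure set (borel T) -> \bar R})
    (f : T -> R[i]) : R[i] :=
  Rintegral mu setT (fun x : borel T => complex.Re (f x)) +i*
  Rintegral mu setT (fun x : borel T => complex.Im (f x)).

(* Integral over [D] of a function with finitely many values on [D], such as a
   locally constant function on a compact set: no topology on V is needed. *)
Definition finite_integral (V : lmodType R[i])
    (mu : {measure set (borel T) -> \bar R}) (D : set T) (f : T -> V) : V :=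
  \sum_(w \in f @` D) (fine (mu (D `&` f @^-1` [set w])))%:C *: w.

End Haar.

(** * Representations *)

Record representation (G : groupType) (K : nzRingType) (V : lmodType K) := {
  raction :> G -> {linear V -> V};
  raction1 : forall v, raction 1%g v = v;
  ractionM : forall g h v, raction (g * h)%g v = raction g (raction h v)
}.

Definition irreducible_rep (G : groupType) (K : nzRingType) (V : lmodType K)
    (pi : representation G V) : Prop :=
  (exists v : V, v != 0) /\
  forall W : {pred V}, GRing.submod_closed W ->
    (forall g v, v \in W -> pi g v \in W) -> W =i pred1 0 \/ W =i predT.

Definition is_min (P : nat -> Prop) (n : nat) : Prop :=
  P n /\ forall m, P m -> (n <= m)%N.

(* [z ^ s] for real [z > 0] and complex [s]. *)
Definition cpow (R : realType) (z : R) (s : R[i]) : R[i] :=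
  (z `^ complex.Re s)%:C *
  (cos (complex.Im s * ln z) +i* sin (complex.Im s * ln z)).

Section Whittaker.
Variables (R : realType) (E : localFieldType) (bar : {rmorphism E -> E}).
Local Notation G := (U3 bar).
Local Notation C := R[i].

(* A nontrivial additive character with conductor o_E; being trivial on the
   open subgroup o_E, it is continuous. *)
Definition additive_char_conductor0 (psi : E -> C) : Prop :=
  [/\ psi 0 = 1,
      forall x y, psi (x + y) = psi x * psi y,
      exists x, psi x != 1,
      forall x, frac_ideal 0 x -> psi x = 1
    & forall k : int, (forall x : E, frac_ideal k x -> psi x = 1) ->
        @frac_ideal E k `<=` frac_ideal 0].

Variables (V : lmodType C) (pi : representation G V).

Definition smooth_rep : Prop := forall v, open [set g : G | pi g v = v].

Definition whittaker_functional (psi : E -> C) (l : {scalar V}) : Prop :=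
  forall (g : G) (x y : E), val g = umx bar x y ->
    forall v, l (pi g v) = psi x * l v.

Definition whittaker_fun (l : {scalar V}) (v : V) : G -> C :=
  fun g => l (pi g v).

Definition central_char (omega : E -> C) : Prop :=
  forall (g : G) (z : E), val g = z%:M -> forall v, pi g v = omega z *: v.

Definition fixed_by (A : set G) : set V :=
  [set v | forall g, A g -> pi g v = v].

Definition conductor (N : nat) : Prop :=
  is_min (fun n => exists2 v, fixed_by (Kn bar n) v & v != 0) N.

Definition central_conductor (omega : E -> C) (n : nat) : Prop :=
  is_min (fun m => forall z, center_n bar m z -> omega z = 1) n.

(* The Hecke operator T on V(n); zeta = diag(varpi, 1, varpi^-1). *)
Definition hecke_op (mu : {measure set (borel G) -> \bar R})
    (zeta : G) (n : nat) (v : V) : V :=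
  ((fine (mu (Kn bar n)))^-1)%:C *:
  finite_integral mu
    [set g | exists k1 k2, [/\ Kn bar n k1, Kn bar n k2
                             & g = (k1 * zeta * k2)%g]]
    (fun k => pi k v).

End Whittaker.

Notation "x %:F" := (tofrac x) : ring_scope.

(* Z(s, W), as an element Phi of C(q^(-2s)): the integral converges absolutely
   for Re s large, and Phi is the rational function of q^(-2s) it equals
   there. *)
Definition is_zeta_integral (R : realType) (E : localFieldType)
    (bar : {rmorphism E -> E})
    (nu : {measure set (borel (units E)) -> \bar R}) (q : nat)
    (W : U3 bar -> R[i]) (Phi : {fraction {poly R[i]}}) : Prop :=
  exists P Q : {poly R[i]}, [/\ Q != 0, Phi = P%:F / Q%:F
    & exists sigma : R, forall s : R[i], sigma < complex.Re s ->
        let integrand := fun a : units E =>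
          W (torus bar a) * cpow (norm_val R (val a)) (s - 1) in
        let X := cpow q%:R (- (2 * s)) in
        [/\ complex_integrable nu integrand, Q.[X] != 0
          & complex_integral nu integrand = P.[X] / Q.[X]]].

(* Main.v *)
Require Import Defs.
From mathcomp Require Import all_boot all_order all_algebra fieldext.
From mathcomp Require Import all_classical all_reals all_analysis.
From mathcomp Require Import measurable_realfun fraction complex.
From mathcomp Require Import zify ring lra.

(** Let [K = K_N], let [zeta] be [diag(varpi, 1, varpi^-1)], and let
    [c_i = W_v(zeta^i)]. As [v] is fixed by the integral torus, [W_v(t(a))]
    depends only on the valuation of [a], and it vanishes when the valuation is
    negative because [psi] is then nontrivial on [a * o_E]. So the zeta integral
    is the series of the [c_i * q^(2i(1-s))], and the theorem amounts to the
    recurrence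
      [lambda * c_0 = q^4 * c_1],
      [lambda * c_i = q^4 * c_(i+1) - q^2 * c_i] for [i > 0],
    which makes the series geometric after its first term.

    The recurrence comes from two coset decompositions, both instances of
    [transversal_cells]. The first splits [K zeta K] into cosets [u zeta K], with
    [q^4] elements [u] of [U], and [t_N u zeta K], with [q^3] elements [u]
    ([hecke_op_cells]). At [zeta^i] the first cell contributes
    [q^4 * c_(i+1)]. The second cell is [pi(t_N)] applied to a vector [v'].

    The second decomposition concerns [K_(N-1)] and the stabiliser of
    [pi(zeta) v] in it. This stabiliser contains [Kcong (N-1) 1], which [zeta]
    conjugates into [Z_(N-1) K] ([Kcong_conj_zeta]); here [N > n_pi] enters, as
    it makes [Z_(N-1)] act trivially. The sum over the representatives is fixed by
    [K_(N-1)], hence zero by minimality of [N] ([trace_eq0]). Its first cell is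
    [v'], so [v'] is minus its second cell, and since [t_N t_(N-1) = zeta^-1],
    the vector [pi(t_N) v'] is minus the sum of the [pi(zeta^-1 u(x, y) zeta) v]
    over [x] in [o_E / p_E] ([hecke_sum_cells]). At [zeta^i] this is [- q^2 * c_i]
    if [i > 0], and it is zero if [i = 0] because a nontrivial character of
    [o_E / p_E] sums to zero.

    The remaining work is of three kinds. Arithmetic of [E / F]: [bar] preserves
    the valuation and there is a unit of trace zero ([unramified_quadraticP]).
    Topology: [K_n] is compact and open, so that its volume is finite and nonzero
    ([haar_Kn]). Integration: the shells of constant valuation have measure one,
    which turns the integral into the series ([shell_integral]). *)

Set Implicit Arguments.
Unset Strict Implicit.
Unset Printing Implicit Defensive.

Import Order.TTheory GRing.Theory Num.Theory.
Local Open Scope classical_set_scope.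
Local Open Scope ring_scope.
Local Open Scope complex_scope.

(** * Fractional ideals of a local field *)

Section Valuation.
Variable E : localFieldType.
Implicit Types (x y : E) (m n : int).

Lemma ordv1 : ordv (1 : E) = 0.
Proof.
have := ordvM _ _ (oner_neq0 E) (oner_neq0 E).
by rewrite mulr1 -[LHS]addr0 => /addrI.
Qed.

Lemma ordvN x : ordv (- x) = ordv x.
Proof.
have [->|x0] := eqVneq x 0; first by rewrite oppr0.
have N1 : (-1 : E) != 0 by rewrite oppr_eq0 oner_neq0.
have := ordvM _ _ N1 N1; rewrite mulrNN mulr1 ordv1 => h.
by rewrite -mulN1r ordvM //; lia.
Qed.

Lemma ordvV x : x != 0 -> ordv x^-1 = - ordv x.
Proof.
move=> x0; have := ordvM _ _ x0 (invr_neq0 x0); rewrite divff // ordv1; lia.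
Qed.

Lemma ordvX x (k : nat) : x != 0 -> ordv (x ^+ k) = ordv x * k%:Z.
Proof.
move=> x0; elim: k => [|k IH]; first by rewrite expr0 ordv1; lia.
by rewrite exprS ordvM ?expf_neq0 // IH; lia.
Qed.

Lemma ordvXz x m : x != 0 -> ordv (x ^ m) = ordv x * m.
Proof.
case: m => k x0; first exact: ordvX.
have -> : x ^ Negz k = (x ^+ k.+1)^-1 by [].
by rewrite ordvV ?expf_neq0 // ordvX // NegzE mulrN.
Qed.

Lemma ideal0 n : frac_ideal n (0 : E). Proof. by left. Qed.

Lemma idealD n x y : frac_ideal n x -> frac_ideal n y -> frac_ideal n (x + y).
Proof.
have [->|x0] := eqVneq x 0; first by rewrite add0r.
have [->|y0] := eqVneq y 0; first by rewrite addr0.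
have [->|s0] := eqVneq (x + y) 0; first by left.
move=> [/eqP|hx]; first by rewrite (negPf x0).
move=> [/eqP|hy]; first by rewrite (negPf y0).
by right; apply: le_trans (ordvD _ _ x0 y0 s0); lia.
Qed.

Lemma idealN n x : frac_ideal n x -> frac_ideal n (- x).
Proof.
by case=> [->|h]; [rewrite oppr0; left|right; rewrite ordvN].
Qed.

Lemma idealB n x y : frac_ideal n x -> frac_ideal n y -> frac_ideal n (x - y).
Proof. by move=> hx hy; apply: idealD => //; apply: idealN. Qed.

Lemma ideal_subC n x y : frac_ideal n (x - y) -> frac_ideal n (y - x).
Proof. by move=> /idealN; rewrite opprB. Qed.

Lemma ideal_sub_trans n x y z :
  frac_ideal n (x - y) -> frac_ideal n (y - z) -> frac_ideal n (x - z).
Proof. by move=> hx hy; rewrite -(subrKA y); apply: idealD. Qed.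

(** The exponent [k] is any bound below [m + n], so that weakening is included. *)
Lemma idealM m n k x y : k <= m + n ->
  frac_ideal m x -> frac_ideal n y -> frac_ideal k (x * y).
Proof.
move=> kmn; have [->|x0] := eqVneq x 0; first by rewrite mul0r; left.
have [->|y0] := eqVneq y 0; first by rewrite mulr0; left.
move=> [/eqP|hx]; first by rewrite (negPf x0).
move=> [/eqP|hy]; first by rewrite (negPf y0).
by right; rewrite ordvM //; lia.
Qed.

Lemma idealW m n x : n <= m -> frac_ideal m x -> frac_ideal n x.
Proof. by move=> nm [->|h]; [left|right; lia]. Qed.

Lemma ideal1 n : n <= 0 -> frac_ideal n (1 : E).
Proof. by move=> n0; right; rewrite ordv1. Qed.

Lemma ideal_ordv n x : x != 0 -> frac_ideal n x -> n <= ordv x.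
Proof. by move=> x0 [/eqP|//]; rewrite (negPf x0). Qed.

Definition ounit x := x != 0 /\ ordv x = 0.

Lemma ounit_ideal x : ounit x -> frac_ideal 0 x.
Proof. by case=> _ ox; right; rewrite ox. Qed.

Lemma ounitP x : frac_ideal 0 x -> ~ frac_ideal 1 x -> ounit x.
Proof.
move=> [->|h] h1; first by case: h1; left.
split; first by apply/eqP => x0; apply: h1; left.
by apply/eqP; rewrite eq_le h andbT; case: leP => // ?; case: h1; right; lia.
Qed.

Lemma ounitNideal x : ounit x -> ~ frac_ideal 1 x.
Proof. by case=> x0 ox /(ideal_ordv x0); lia. Qed.

Lemma ounitV x : ounit x -> ounit x^-1.
Proof. by case=> x0 ox; split; [rewrite invr_eq0|rewrite ordvV //; lia]. Qed.

Lemma ounit1 : ounit 1. Proof. by split; [exact: oner_neq0|exact: ordv1]. Qed.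

Lemma ounit_congr x y : ounit x -> frac_ideal 1 (y - x) -> ounit y.
Proof.
move=> ux yx; apply: ounitP.
  rewrite -(subrK x y); apply: idealD; last exact: ounit_ideal.
  exact: idealW yx.
move=> y1; apply: (ounitNideal ux); rewrite -(subKr y x); exact: idealB.
Qed.

(** The hermitian identities produce units in this form: a product that differs
    from [1] by an element of [p_E]. *)
Lemma ounit_mul_eq1 x y z : frac_ideal 0 x -> frac_ideal 0 y ->
  frac_ideal 1 z -> x * y + z = 1 -> ounit x /\ ounit y.
Proof.
move=> hx hy hz e.
have u : ounit (x * y).
  by apply: (ounit_congr ounit1); rewrite -e opprD addNKr; exact: idealN.
have h := ounitNideal u.
split; apply: ounitP => // k; apply: h.
  by apply: idealM k hy.
by apply: idealM hx k.
Qed.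

Lemma ideal_mul_unit n x y : ounit x -> frac_ideal n (x * y) -> frac_ideal n y.
Proof.
move=> ux h; have [x0 _] := ux; rewrite -[y](mulKf x0).
by apply: idealM (ounit_ideal (ounitV ux)) h; lia.
Qed.

Lemma ideal_uniformizer_mul (w : E) n m x : uniformizer w ->
  frac_ideal n (w ^ m * x) <-> frac_ideal (n - m) x.
Proof.
move=> [w0 ow]; have wm0 : w ^ m != 0 by rewrite expfz_neq0.
have owm : ordv (w ^ m) = m by rewrite ordvXz // ow; lia.
split=> [h|h]; last by apply: idealM h; [|right; rewrite owm; exact: lexx]; lia.
rewrite -[x](mulKf wm0); apply: idealM h; last first.
  by right; rewrite ordvV // owm; exact: lexx.
by lia.
Qed.

End Valuation.

(** * Class representatives and the unramified quadratic extension *)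

Section Representatives.
Variable E : localFieldType.

(** [A] is either the whole field, or the field fixed by [bar]; in the second
    case [r] represents [o_F / p_F^k] inside [E]. *)
Definition reps_mod (A : set E) (I : finType) (k : int) (r : I -> E) :=
  [/\ forall i, A (r i) /\ frac_ideal 0 (r i),
      forall x, A x -> frac_ideal 0 x -> exists i, frac_ideal k (x - r i)
    & forall i j, frac_ideal k (r i - r j) -> i = j].

Lemma residue_reps :
  exists r : 'I_(residue_card E) -> E, reps_mod setT 1 r.
Proof.
have := @residue_cardP E; set n := residue_card E.
rewrite card_eq_sym => /card_set_bijP[f [fF fI fS]].
have hr (i : 'I_n) : exists x, frac_ideal 0 x /\
    f i = [set y | frac_ideal 1 (y - x)].
  have [|x x0 <-] := fF i; first by rewrite /=; exact: ltn_ord.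
  by exists x.
have [r rP] := choice hr; exists r; split=> [i|x _ x0|i j ij].
- by split=> //; have [] := rP i.
- have [|k kn fk] := fS [set y | frac_ideal 1 (y - x)]; first by exists x.
  exists (Ordinal kn); have [_ /= e] := rP (Ordinal kn).
  have : f k x by rewrite fk /= subrr; left.
  by rewrite e.
- apply/val_inj/fI; rewrite ?inE /=; try exact: ltn_ord.
  have [_ ->] := rP i; have [_ ->] := rP j.
  apply/seteqP; split=> y /= h; apply: ideal_sub_trans h _ => //.
  exact: ideal_subC.
Qed.

(** The classes modulo [p_E^k] are the expansions with [k] digits along a
    uniformizer, whence their number. *)
Lemma reps_mod_exp (k : nat) : exists (I : finType) (r : I -> E),
  #|I| = (residue_card E ^ k)%N /\ reps_mod setT k r.
Proof.
have [w w0 ow] := @ordv_normalized E.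
have uw : uniformizer w by [].
have [s [s0 sx si]] := residue_reps.
elim: k => [|k [I [r [cI [r0 rx ri]]]]].
  exists unit, (fun=> 0); rewrite card_unit expn0; split=> //; split.
  - by move=> _; split=> //; left.
  - by move=> x _ x0; exists tt; rewrite subr0.
  - by case; case.
exists (I * 'I_(residue_card E))%type, (fun ij => r ij.1 + w ^ k * s ij.2).
split; first by rewrite card_prod cI card_ord expnSr.
split=> [[i j]|x _ x0|[i j] [i' j']] /=.
- split=> //; apply: idealD; first by have [] := r0 i.
  apply/(ideal_uniformizer_mul _ _ _ uw); apply: idealW (s0 j).2; lia.
- have [i hi] := rx x Logic.I x0.
  have [|j hj] := sx (w ^ (- k%:Z) * (x - r i)) Logic.I.
    by apply/(ideal_uniformizer_mul _ _ _ uw); apply: idealW hi; lia.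
  exists (i, j); rewrite /= opprD addrA.
  have -> : x - r i - w ^ k * s j =
      w ^ k * (w ^ (- k%:Z) * (x - r i) - s j).
    by rewrite mulrBr mulrA -expfzDr // subrr expr0z mul1r.
  by apply/(ideal_uniformizer_mul _ _ _ uw); apply: idealW hj; lia.
- move=> h; have eii : i = i'.
    apply: ri; have hs j1 : frac_ideal k (w ^ k * s j1).
      by apply/(ideal_uniformizer_mul _ _ _ uw); apply: idealW (s0 j1).2; lia.
    have -> : r i - r i' =
        r i + w ^ k * s j - (r i' + w ^ k * s j') - w ^ k * s j + w ^ k * s j'.
      ring.
    apply: idealD => //; apply: idealB => //; apply: idealW h; lia.
  subst i'; congr (_, _); apply: si.
  have {}h : frac_ideal k.+1 (w ^ k * (s j - s j')).
    by move: h; rewrite mulrBr opprD addrACA subrr add0r.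
  move/(ideal_uniformizer_mul _ _ _ uw): h; apply: idealW; lia.
Qed.

Lemma residue_card_gt1 : (1 < residue_card E)%N.
Proof.
have [s [s0 sx si]] := residue_reps.
have [i hi] := sx 0 Logic.I (ideal0 _ _).
have [j hj] := sx 1 Logic.I (ideal1 _ (lexx _)).
have : i != j.
  apply/eqP => ij; subst j; apply: (ounitNideal (ounit1 E)).
  rewrite -(subr0 (1 : E)); apply: ideal_sub_trans hj _.
  exact: ideal_subC.
have := ltn_ord i; have := ltn_ord j; rewrite -val_eqE /=; lia.
Qed.

End Representatives.

Section UnramifiedQuadratic.
Variables (F : localFieldType) (E : localFieldExtType F).
Hypothesis hE : unramified_quadratic E.
Variable bar : {lrmorphism E -> E}.
Hypothesis hbar : exists x, bar x != x.

Let ideal_alg n (a : F) : frac_ideal n (a%:A : E) <-> frac_ideal n a.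
Proof.
have [_ hv _] := hE.
have [->|a0] := eqVneq a 0; first by rewrite scale0r; split; left.
have aE : (a%:A : E) != 0 by rewrite scaler_eq0 (negPf a0) oner_eq0.
by split=> /ideal_ordv; rewrite ?hv // => /(_ _) h; right; rewrite ?hv // h.
Qed.

(** If [o_F] met all residue classes of [E], the residue field of [E] would have
    at most [q] elements instead of [q ^ 2]. *)
Let exists_theta : exists t : E,
  frac_ideal 0 t /\ forall a : F, ~ frac_ideal 1 (t - a%:A).
Proof.
apply: contrapT => hn.
have [r [r0 rx ri]] := residue_reps E.
have [s [s0 sx si]] := residue_reps F.
have hj (i : 'I_(residue_card E)) : exists j : 'I_(residue_card F),
    frac_ideal 1 (r i - (s j)%:A).
  have [a ha] : exists a : F, frac_ideal 1 (r i - a%:A).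
    apply: contrapT => hi; apply: hn; exists (r i); split; first exact: (r0 i).2.
    by move=> a ha; apply: hi; exists a.
  have a0 : frac_ideal 0 a.
    apply/ideal_alg; rewrite -[a%:A](subKr (r i)).
    by apply: idealB; [exact: (r0 i).2|exact: idealW ha].
  have [j h] := sx a Logic.I a0; exists j; apply: ideal_sub_trans ha _.
  by rewrite -scalerBl; apply/ideal_alg.
have [f fP] := choice hj.
have : (#|'I_(residue_card E)| <= #|'I_(residue_card F)|)%N.
  apply: (leq_card f) => i j e; apply: ri; apply: ideal_sub_trans (fP i) _.
  by rewrite e; apply: ideal_subC; exact: fP.
rewrite !card_ord; have [_ _ ->] := hE; have := residue_card_gt1 F.
by move=> q1; rewrite expnS expn1 -[X in (_ <= X)%N]muln1 leq_pmul2l //; lia.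
Qed.

Section Theta.
Variable t : E.
Hypotheses (t0 : frac_ideal 0 t) (tF : forall a : F, ~ frac_ideal 1 (t - a%:A)).

(** [1, t] is an orthogonal basis for the valuation: if [b] had too small a
    valuation, dividing by [b] would make [t] congruent to [- a / b]. *)
Let theta_coord n (a b : F) :
  frac_ideal n (a%:A + b%:A * t) -> frac_ideal n a /\ frac_ideal n b.
Proof.
move=> h; suff hb : frac_ideal n b.
  split=> //; apply/ideal_alg; rewrite -[a%:A](addrK (b%:A * t)).
  apply: idealB => //; apply: idealM t0; first by rewrite addr0.
  exact/ideal_alg.
have [->|b0] := eqVneq b 0; first by left.
right; case: lerP => // bn; case: (tF (a := - (a / b))).
have -> : t - (- (a / b))%:A = (b^-1)%:A * (a%:A + b%:A * t).
  rewrite mulrDr mulrA -![_%:A * _%:A]scalerAl !mul1r !scalerA mulVf // scale1r.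
  by rewrite mul1r scaleNr opprK addrC mulrC.
apply: idealM h; last by apply/ideal_alg; right; rewrite ordvV.
lia.
Qed.

Let theta_span (x : E) : exists a b : F, x = a%:A + b%:A * t.
Proof.
have [dim2 _ _] := hE.
have fr : free [:: t; 1].
  rewrite free_cons seq1_free oner_eq0 andbT span_seq1; apply/vlineP => -[k e].
  by apply: (tF (a := k)); rewrite e subrr; left.
have : x \in <<[:: t; 1]>>%VS.
  suff -> : <<[:: t; 1]>>%VS = fullv by rewrite memvf.
  apply/eqP; rewrite eqEdim subvf /=.
  by have := fr; rewrite /free dim2 => /eqP ->.
rewrite span_cons span_seq1 => /memv_addP[u /vlineP[b ->] [v /vlineP[a ->] ->]].
by exists a, b; rewrite addrC -scalerAl mul1r.
Qed.

Let bar_alg (a : F) : bar a%:A = a%:A.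
Proof. by rewrite linearZ rmorph1. Qed.

Let theta_quadratic : exists s : F, frac_ideal 0 s /\ bar t = s%:A - t.
Proof.
have [u [s e]] := theta_span (t * t).
have [_ s0] : frac_ideal 0 u /\ frac_ideal 0 s.
  by apply: theta_coord; rewrite -e; apply: idealM t0 t0.
exists s; split=> //.
have : (bar t - t) * (bar t + t - s%:A) = 0.
  have e2 := congr1 bar e; rewrite rmorphM rmorphD rmorphM /= !bar_alg in e2.
  transitivity ((bar t * bar t - s%:A * bar t) - (t * t - s%:A * t)).
    ring.
  by rewrite e e2; ring.
move/eqP; rewrite mulf_eq0 !subr_eq0 => /orP[/eqP tt|/eqP <-]; last by ring.
have [x /eqP[]] := hbar.
have [a [b ->]] := theta_span x.
by rewrite rmorphD rmorphM /= !bar_alg tt.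
Qed.

Let bar_involutive : involutive bar.
Proof.
have [s [s0 bt]] := theta_quadratic.
move=> x; have [a [b ->]] := theta_span x.
rewrite !(rmorphD, rmorphM) /= !bar_alg bt rmorphB /= bar_alg bt; ring.
Qed.

(** The conjugate of [t] is integral, being the trace of [t] minus [t], and
    coordinates in the basis [1, t] detect the valuation. *)
Let bar_ideal n (x : E) : frac_ideal n x -> frac_ideal n (bar x).
Proof.
have [s [s0 bt]] := theta_quadratic.
have [a [b ->]] := theta_span x => /theta_coord[an bn].
rewrite rmorphD rmorphM /= !bar_alg bt; apply: idealD; first exact/ideal_alg.
apply: (@idealM _ n 0); first by lia.
  exact/ideal_alg.
by apply: idealB => //; exact/ideal_alg.
Qed.

Let two_neq0 : ounit (2 : F) -> (2 : E) != 0.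
Proof.
move=> [two _]; apply: contra_neq two => e.
have : (2 : F)%:A = 0 :> E by rewrite scaler_nat.
by move/eqP; rewrite scaler_eq0 oner_eq0 orbF => /eqP.
Qed.

Let bar_fixed (x : E) : ounit (2 : F) -> bar x = x -> exists a : F, x = a%:A.
Proof.
move=> two; have [s [s0 bt]] := theta_quadratic.
have [a [b ->]] := theta_span x; rewrite rmorphD rmorphM /= !bar_alg bt.
move/addrI => e; exists a; have [->|b0] := eqVneq b 0.
  by rewrite scale0r mul0r addr0.
have /mulfI/(_ _ _ e) st : b%:A != 0 :> E by rewrite scaler_eq0 (negPf b0) oner_eq0.
case: (tF (a := s / 2)); left; apply/eqP; rewrite subr_eq0; apply/eqP.
apply: (mulfI (two_neq0 two)); transitivity (s%:A : E).
  by rewrite mulr_natl mulr2n -{1}st subrK.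
rewrite mulr_natl -scaler_nat scalerA mulrC divfK //; exact: two.1.
Qed.

Let delta_unit : ounit (2 : F) -> ounit (t - bar t).
Proof.
move=> two; have [s [s0 bt]] := theta_quadratic.
have e : t - bar t = (- s)%:A + (2 : F)%:A * t.
  by rewrite bt scaleNr scaler_nat mulr_natl; ring.
apply: ounitP; first by apply: idealB => //; exact: bar_ideal.
by rewrite e => /theta_coord[_]; exact: ounitNideal.
Qed.

Lemma unramified_quadratic_theta : ounit (2 : F) ->
  [/\ involutive bar,
      forall n x, frac_ideal n x -> frac_ideal n (bar x),
      ounit (t - bar t)
    & forall x, bar x = x -> exists a : F, x = a%:A].
Proof.
move=> two; split; [exact: bar_involutive|exact: bar_ideal|exact: delta_unit|].
by move=> x; exact: bar_fixed.
Qed.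

End Theta.

(** The facts on [E / F] used below. The element [d] generates the line of
    trace zero; for odd residual characteristic [t - bar t] is such a unit. *)
Lemma unramified_quadraticP : ounit (2 : F) ->
  [/\ involutive bar,
      forall n x, frac_ideal n x -> frac_ideal n (bar x),
      exists2 d, ounit d & bar d = - d
    & forall k : nat, exists (I : finType) (r : I -> E),
        #|I| = (residue_card F ^ k)%N /\ reps_mod [set x | bar x = x] k r].
Proof.
move=> two; have [t [t0 tF]] := exists_theta.
have [bK bI du fx] := unramified_quadratic_theta t0 tF two.
split=> //; first by exists (t - bar t) => //; rewrite rmorphB /= bK opprB.
move=> k; have [I [r [cI [r0 rx ri]]]] := reps_mod_exp F k.
exists I, (fun i => (r i)%:A); split=> //; split=> [i|x /fx[a ->]|i j].
- by rewrite /= linearZ rmorph1; split=> //; apply/ideal_alg; exact: (r0 i).2.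
- move/ideal_alg => a0; have [i hi] := rx a Logic.I a0.
  by exists i; rewrite -scalerBl; apply/ideal_alg.
- by rewrite -scalerBl => /ideal_alg; exact: ri.
Qed.

Lemma uniformizer_alg (w : F) : uniformizer w ->
  uniformizer (w%:A : E) /\ bar w%:A = w%:A.
Proof.
move=> [w0 ow]; rewrite linearZ rmorph1; split=> //; split.
  by rewrite scaler_eq0 (negPf w0) oner_eq0.
by have [_ -> //] := hE.
Qed.

Lemma ounit_nat_alg : ounit (2 : F) -> ounit (2 : E).
Proof.
move=> two; have -> : (2 : E) = (2 : F)%:A by rewrite scaler_nat.
apply: ounitP; first by apply/ideal_alg/ounit_ideal.
by move/ideal_alg; exact: ounitNideal.
Qed.

End UnramifiedQuadratic.

(** If [2] and the odd number [p] lay in [p_F], so would [1]. *)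
Lemma ounit_two (F : localFieldType) (p : nat) :
  residue_char F p -> odd p -> ounit (2 : F).
Proof.
move=> [_ hp] op; apply: ounitP => [|h2].
  by rewrite (_ : 2 = 1 + 1 :> F) //; apply: idealD; exact: ideal1.
apply: (ounitNideal (ounit1 F)); rewrite -(addrK (2 * (p./2)%:R) (1 : F)).
apply: idealB; last first.
  apply: (@idealM _ 1 0) => //.
  elim: p./2 => [|k IH]; first by left.
  by rewrite -natr1; apply: idealD => //; exact: ideal1.
rewrite -natrM mul2n nat1r -add1n; suff -> : (1 + p./2.*2)%N = p by [].
by rewrite -[RHS]odd_double_half op.
Qed.

(** * Entries of unitary matrices and the groups [K_n] *)

Section UnitaryGroup.
Variables (E : localFieldType) (bar : {rmorphism E -> E}).
Local Notation G := (U3 bar).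
Implicit Types (g h : G) (n : nat).

Lemma U3_sum3 (f : 'I_3 -> E) :
  \sum_i f i = f (inord 0) + f (inord 1) + f (inord 2).
Proof.
rewrite !big_ord_recl big_ord0 addr0 addrA.
by congr (f _ + f _ + f _); apply/val_inj; rewrite /= inordK.
Qed.

Lemma entryM g h i j : entry (g * h)%g i j =
  entry g i 0 * entry h 0 j + entry g i 1 * entry h 1 j
  + entry g i 2 * entry h 2 j.
Proof. by rewrite /entry /= mxE U3_sum3. Qed.

Lemma entry1 i j : (i < 3)%N -> (j < 3)%N ->
  entry (1%g : G) i j = (i == j)%:R.
Proof. by move=> i3 j3; rewrite /entry /= mxE -val_eqE /= !inordK. Qed.

(** Since [J] is an involution, the hermitian condition says that the inverse of
    [g] is [J *m (bar g)^T *m J]. *)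
Lemma entryV g i j : (i < 3)%N -> (j < 3)%N ->
  entry (g^-1)%g i j = bar (entry g (2 - j) (2 - i)).
Proof.
move=> i3 j3.
have gu := unitary_mx_unit (valP g).
have e : invmx (val g) = antidiag E *m (map_mx bar (val g))^T *m antidiag E.
  set M := RHS; suff Mg : M *m val g = 1%:M.
    by rewrite -[M]mulmx1 -(mulmxV gu) mulmxA Mg mul1mx.
  by rewrite /M -!mulmxA (mulmxA _ _ (val g)) (eqP (valP g)) antidiag_sqr.
have i2 : inord i = rev_ord (inord (2 - i)) :> 'I_3.
  by apply/val_inj; rewrite /= !inordK; lia.
have j2 : inord j = rev_ord (inord (2 - j)) :> 'I_3.
  by apply/val_inj; rewrite /= !inordK; lia.
have J (k l : 'I_3) : antidiag E k l = (k == rev_ord l)%:R.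
  have -> : (k == rev_ord l) = (k + l == 2)%N.
    by rewrite -val_eqE /=; have := ltn_ord k; have := ltn_ord l; lia.
  by rewrite mxE.
rewrite /entry /= e mxE (bigD1 (inord (2 - j))) //= big1 => [|k kj].
  rewrite addr0 J j2 rev_ordK eqxx mulr1 mxE (bigD1 (inord (2 - i))) //= big1.
    by rewrite J -i2 eqxx mul1r addr0 !mxE.
  by move=> k ki; rewrite J i2 (inj_eq rev_ord_inj) eq_sym (negPf ki) mul0r.
by rewrite J j2 rev_ordK (negPf kj) mulr0.
Qed.

Lemma entryP g h :
  (forall i j, (i < 3)%N -> (j < 3)%N -> entry g i j = entry h i j) -> g = h.
Proof.
move=> e; apply/val_inj/matrixP => i j.
by have := e i j (ltn_ord i) (ltn_ord j); rewrite /entry !inord_val.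
Qed.

(** All constraints between the entries of [g] are drawn from this identity: for
    [i = j = 2] the last column is isotropic, for [i = 0] and [j = 2] it
    exhibits unit entries. *)
Lemma entry_herm g i j : (i < 3)%N -> (j < 3)%N ->
  bar (entry g 2 i) * entry g 0 j + bar (entry g 1 i) * entry g 1 j
  + bar (entry g 0 i) * entry g 2 j = (i + j == 2)%:R.
Proof.
move=> i3 j3; have := entryM (g^-1)%g g (2 - i) j.
rewrite mulVg entry1 ?entryV //; try lia.
rewrite !subKn //; move=> <-.
by have -> : (2 - i == j)%N = (i + j == 2)%N by lia.
Qed.

Lemma entry_mx3 g (a b c d e f a' b' c' : E) :
  val g = mx3 a b c d e f a' b' c' -> forall i j, (i < 3)%N -> (j < 3)%N ->
  entry g i j =
    nth 0 (nth [::] [:: [:: a; b; c]; [:: d; e; f]; [:: a'; b'; c']] i) j.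
Proof. by move=> eg i j i3 j3; rewrite /entry eg mxE !inordK. Qed.

Definition mxU3 (M : 'M[E]_3) : G := insubd (1%g : G) M.

Lemma val_mxU3 M : unitary_mx bar M -> val (mxU3 M) = M.
Proof. by move=> h; rewrite /mxU3 insubdK. Qed.

Hypothesis barK : involutive bar.
Hypothesis bar_ideal : forall (k : int) x, frac_ideal k x -> frac_ideal k (bar x).

Lemma bar_ounit x : ounit x -> ounit (bar x).
Proof.
move=> ux; apply: ounitP; first by apply/bar_ideal/ounit_ideal.
by move/bar_ideal; rewrite barK; exact: ounitNideal.
Qed.

Let mx3_unitary a b c d e f a' b' c' :
  [/\ [/\ bar a' * a + bar d * d + bar a * a' = 0,
      bar a' * b + bar d * e + bar a * b' = 0
    & bar a' * c + bar d * f + bar a * c' = 1],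
      [/\ bar b' * a + bar e * d + bar b * a' = 0,
      bar b' * b + bar e * e + bar b * b' = 1
    & bar b' * c + bar e * f + bar b * c' = 0]
    & [/\ bar c' * a + bar f * d + bar c * a' = 1,
      bar c' * b + bar f * e + bar c * b' = 0
    & bar c' * c + bar f * f + bar c * c' = 0]] ->
  unitary_mx bar (mx3 a b c d e f a' b' c').
Proof.
move=> [[h1 h2 h3] [h4 h5 h6] [h7 h8 h9]]; apply/eqP/matrixP => i j.
rewrite !mxE !big_ord_recl big_ord0 !mxE !big_ord_recl !big_ord0 !mxE.
case: i => [[|[|[|]]] //= ?]; case: j => [[|[|[|]]] //= ?];
  by rewrite /= ?(mulr0, mulr1, addr0, add0r) addrA.
Qed.

Definition ug (x y : E) : G := mxU3 (umx bar x y).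

Lemma val_ug x y : y + bar y + x * bar x = 0 -> val (ug x y) = umx bar x y.
Proof.
move=> e; apply/val_mxU3/mx3_unitary.
rewrite !(rmorph0, rmorph1, rmorphN) /= !barK; split; split; try by ring.
by rewrite -[RHS]e; ring.
Qed.

(** The nontrivial Weyl element [t_n] of [K_n]; it exchanges the two cells of
    [K_n] relative to [U]. *)
Definition tg (w : E) n : G :=
  mxU3 (mx3 0 0 (w ^- n) 0 1 0 (w ^+ n) 0 0).

Lemma val_tg w n : w != 0 -> bar w = w ->
  val (tg w n) = mx3 0 0 (w ^- n) 0 1 0 (w ^+ n) 0 0.
Proof.
move=> w0 bw; have wn : w ^+ n != 0 by rewrite expf_neq0.
apply/val_mxU3/mx3_unitary.
rewrite !(rmorph0, rmorph1, fmorphV, rmorphXn) /= bw.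
by split; split; rewrite ?(mulr0, mul0r, addr0, add0r, mulfV, mulVf, mulr1).
Qed.

Lemma val_torus (a : units E) : val (torus bar a) = tmx bar (val a).
Proof. by rewrite /torus insubdK //; apply: tmx_unitary => //; exact: (valP a). Qed.

End UnitaryGroup.

(** Bounds a polynomial expression term by term; each product must be covered by
    bounds in the context for both factors. *)
Ltac ideal_auto :=
  repeat first [assumption | apply: idealD | apply: idealN];
  match goal with
  | h1 : frac_ideal ?m ?x, h2 : frac_ideal ?n ?y |- frac_ideal ?k (?x * ?y) =>
    apply: (@idealM _ m n k x y _ h1 h2); lia
  | h : frac_ideal ?m ?x |- frac_ideal ?k ?x => apply: (@idealW _ m k x _ h); lia
  end.

Section OpenSubgroups.
Variables (E : localFieldType) (bar : {rmorphism E -> E}).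
Local Notation G := (U3 bar).
Implicit Types (g h : G) (n m d : nat).
Hypothesis barK : involutive bar.
Hypothesis bar_ideal : forall (k : int) x, frac_ideal k x -> frac_ideal k (bar x).

Lemma ideal_unit_of_congr n (x : E) : frac_ideal n%:Z (x - 1) -> frac_ideal 0 x.
Proof.
move=> h; rewrite -(subrK 1 x); apply: idealD; last exact: ideal1.
by apply: idealW h; lia.
Qed.

Lemma KnM n g h : Kn bar n g -> Kn bar n h -> Kn bar n (g * h)%g.
Proof.
move=> [[g00 g01 g02] [g10 g11 g12] [g20 g21 g22]].
move=> [[h00 h01 h02] [h10 h11 h12] [h20 h21 h22]].
have g11' := ideal_unit_of_congr g11; have h11' := ideal_unit_of_congr h11.
split; split; rewrite entryM; try ideal_auto.
have -> : forall a b c d e f : E, a * b + c * d + e * f - 1 =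
   a * b + ((c - 1) * d + (d - 1)) + e * f by move=> *; ring.
ideal_auto.
Qed.

Lemma KnV n g : Kn bar n g -> Kn bar n g^-1%g.
Proof.
move=> [[g00 g01 g02] [g10 g11 g12] [g20 g21 g22]].
split; split; rewrite entryV //=; try exact: bar_ideal.
by rewrite -(rmorph1 bar) -rmorphB; exact: bar_ideal.
Qed.

Lemma Kn1 n : Kn bar n 1%g.
Proof.
by split; split; rewrite entry1 //= ?subrr; by [left | exact: ideal1].
Qed.

(** [K_m] intersected with the conjugate of [K_m] (for [d = 2]) or of
    [Z_m K_(m+1)] (for [d = 1]) by [zeta]. *)
Definition Kcong m d : set G := [set g | [/\ Kn bar m g,
  frac_ideal 1 (entry g 0 1), frac_ideal 1 (entry g 1 2)
  & frac_ideal (d%:Z - m%:Z) (entry g 0 2)]].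

Lemma KcongM m d g h : (0 < d <= m)%N -> Kcong m d g -> Kcong m d h ->
  Kcong m d (g * h)%g.
Proof.
move=> dm [gK g1 g2 g3] [hK h1 h2 h3]; split; first exact: KnM.
all: have [[g00 g01 g02] [g10 g11 g12] [g20 g21 g22]] := gK.
all: have [[h00 h01 h02] [h10 h11 h12] [h20 h21 h22]] := hK.
all: have g11' := ideal_unit_of_congr g11; have h11' := ideal_unit_of_congr h11.
all: clear g01 h01 g02 h02 g12 h12; rewrite entryM; ideal_auto.
Qed.

Lemma KcongV m d g : Kcong m d g -> Kcong m d g^-1%g.
Proof.
move=> [gK g1 g2 g3]; split; first exact: KnV.
all: by rewrite entryV //=; exact: bar_ideal.
Qed.

End OpenSubgroups.

(** * Coset representatives in [K_m] *)

(** [s] represents the cosets [A / H]; only the closure properties of [A] and [H]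
    are used, so these remain plain sets. *)
Definition transversal (G : groupType) (A H : set G) (I : finType) (s : I -> G) :=
  [/\ forall i, A (s i),
      forall a, A a -> exists i, H ((s i)^-1 * a)%g
    & forall i j, H ((s i)^-1 * s j)%g -> i = j].

Section Transversals.
Variables (E : localFieldType) (bar : {rmorphism E -> E}).
Local Notation G := (U3 bar).
Implicit Types (g h : G) (m d k : nat) (e : int) (x y b : E).
Hypothesis barK : involutive bar.
Hypothesis bar_ideal : forall (k : int) x, frac_ideal k x -> frac_ideal k (bar x).
Hypothesis two_unit : ounit (2 : E).
Variables (w delta : E).
Hypotheses (uw : uniformizer w) (bar_w : bar w = w).
Hypotheses (delta_unit : ounit delta) (bar_delta : bar delta = - delta).

Let bar_wz e : bar (w ^ e) = w ^ e.
Proof. by rewrite fmorphXz bar_w. Qed.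

Let wzK e x : w ^ e * (w ^ (- e) * x) = x.
Proof.
by rewrite mulrA -expfzDr ?subrr ?expr0z ?mul1r //; case: uw.
Qed.

(** A parametrisation of [U] by [x] and by an element [b] of the field fixed by
    [bar]: the trace-zero line is spanned by [delta]. *)
Definition sx x b : G := ug bar x (- (x * bar x) / 2 + delta * b).

Lemma sx_herm x b : bar b = b ->
  let y := - (x * bar x) / 2 + delta * b in y + bar y + x * bar x = 0.
Proof.
move=> bb /=; have t0 : (2 : E) != 0 by case: two_unit.
rewrite rmorphD !rmorphM fmorphV rmorphN rmorphM barK bar_delta bb rmorph_nat.
by field.
Qed.

Lemma entry_sx x b : bar b = b -> forall i j, (i < 3)%N -> (j < 3)%N ->
  entry (sx x b) i j =
  nth 0 (nth [::] [:: [:: 1; x; - (x * bar x) / 2 + delta * b];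
                      [:: 0; 1; - bar x]; [:: 0; 0; 1]] i) j.
Proof. by move=> bb; apply/entry_mx3/val_ug => //; exact: sx_herm. Qed.

Lemma entry_sxV x b : bar b = b -> forall i j, (i < 3)%N -> (j < 3)%N ->
  entry (sx x b)^-1%g i j =
  nth 0 (nth [::] [:: [:: 1; - x; - (x * bar x) / 2 - delta * b];
                      [:: 0; 1; bar x]; [:: 0; 0; 1]] i) j.
Proof.
move=> bb i j i3 j3; rewrite entryV // entry_sx //; try lia.
case: i i3 => [|[|[|//]]] _; case: j j3 => [|[|[|//]]] _ /=;
  rewrite ?(rmorph0, rmorph1, rmorphN) //= ?barK //.
rewrite rmorphD !rmorphM fmorphV rmorphN rmorphM barK bar_delta bb rmorph_nat.
by rewrite (mulrC (bar x)) [- delta * b]mulNr.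
Qed.

Let half_norm x : frac_ideal 0 x -> frac_ideal 0 (x * bar x / 2).
Proof.
move=> x0; have b0 := bar_ideal x0; have t0 := ounit_ideal (ounitV two_unit).
exact: (@idealM _ 0 0 0 _ _ isT (@idealM _ 0 0 0 _ _ isT x0 b0) t0).
Qed.

Lemma ideal_sx02 e x b : e <= 0 -> frac_ideal 0 x -> frac_ideal e b ->
  frac_ideal e (- (x * bar x) / 2 + delta * b).
Proof.
move=> e0 x0 hb; apply: idealD.
  by rewrite mulNr; apply: idealN; apply: idealW (half_norm x0).
by have d0 := ounit_ideal delta_unit; apply: idealM d0 hb; rewrite add0r.
Qed.

Lemma Kn_sx m x b : bar b = b -> frac_ideal 0 x -> frac_ideal (- m%:Z) b ->
  Kn bar m (sx x b).
Proof.
move=> bb x0 hb; split; split; rewrite entry_sx //=; try exact: ideal0.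
- exact: ideal1.
- by apply: ideal_sx02 => //; lia.
- by rewrite subrr; left.
- by apply/idealN/bar_ideal.
- exact: ideal1.
Qed.

Let t_ m : G := tg bar w m.

Lemma entry_tg m i j : (i < 3)%N -> (j < 3)%N ->
  entry (t_ m) i j =
  nth 0 (nth [::] [:: [:: 0; 0; w ^ (- m%:Z)]; [:: 0; 1; 0];
                      [:: w ^ m; 0; 0]] i) j.
Proof.
have w0 : w != 0 by case: uw.
by rewrite -(exprnN w m); apply/entry_mx3/val_tg.
Qed.

Lemma tgK m : (t_ m * t_ m)%g = 1%g.
Proof.
apply: entryP => i j i3 j3; rewrite entryM !entry_tg // entry1 //.
have w0 : w != 0 by case: uw.
case: i i3 => [|[|[|//]]] _; case: j j3 => [|[|[|//]]] _ /=;
  rewrite ?(mul0r, mulr0, add0r, addr0, mulr1) // -expfzDr //.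
- by rewrite addNr expr0z.
- by rewrite subrr expr0z.
Qed.

Let ideal_w e : frac_ideal e (w ^ e).
Proof. by case: uw => w0 ow; right; rewrite ordvXz // ow mul1r. Qed.

Lemma Kn_tg m : Kn bar m (t_ m).
Proof.
split; split; rewrite entry_tg //=; try exact: ideal0; try exact: ideal_w.
by rewrite subrr; left.
Qed.

(** Reduction modulo [p_E] of the identity between the first and last columns
    leaves [bar g00 * g22 = 1]. *)
Lemma Kcong_unit m d g : (0 < d <= m)%N -> Kcong m d g -> ounit (entry g 2 2).
Proof.
move=> dm [[[g00 _ _] [g10 _ _] [g20 _ g22]] g1 g2 g3].
have := entry_herm g (isT : 0 < 3)%N (isT : 2 < 3)%N.
rewrite addrC => /ounit_mul_eq1[] //; first exact: bar_ideal.
apply: idealD; first by apply: idealM (bar_ideal g20) g3; lia.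
by apply: idealM (bar_ideal g10) g2; lia.
Qed.

Section Cells.
Variables (m d : nat) (hd : (0 < d <= m)%N).
Variables (IX : finType) (r : IX -> E).
Hypothesis hr : reps_mod setT 1 r.

Section OneCell.
Variables (k : nat) (e : int) (hek : e + k%:Z = d%:Z - m%:Z) (hem : - m%:Z <= e).
Variables (IB : finType) (s : IB -> E).
Hypothesis hs : reps_mod [set x | bar x = x] k s.

Let s_fixed j : bar (w ^ e * s j) = w ^ e * s j.
Proof. by rewrite rmorphM bar_wz; have [/(_ j)[-> ]] := hs. Qed.

Let s_ideal j : frac_ideal e (w ^ e * s j).
Proof.
apply/(ideal_uniformizer_mul _ _ _ uw); rewrite subrr.
by have [/(_ j)[]] := hs.
Qed.

Let r_ideal i : frac_ideal 0 (r i). Proof. by have [/(_ i)[]] := hr. Qed.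

Lemma Kn_cell i j : Kn bar m (sx (r i) (w ^ e * s j)).
Proof. by apply: Kn_sx => //; apply: idealW (s_ideal j). Qed.

(** Dividing the last column of [g] by its unit entry gives the last column of
    an element of [U]; modulo [p_E] and [p_E^(d-m)] it is determined by one
    class of [o_E / p_E] and one trace-zero class. *)
Lemma cell_cover g : Kn bar m g -> ounit (entry g 2 2) ->
  frac_ideal e (entry g 0 2) ->
  exists i j, Kcong m d ((sx (r i) (w ^ e * s j)%R)^-1 * g)%g.
Proof.
move=> gK g22 g02; have [[_ _ _] [_ _ g12] _] := gK.
have [_ rx _] := hr; have [_ sb _] := hs.
have g22i := ounit_ideal g22; have [g220 _] := g22.
have g22V := ounit_ideal (ounitV g22); have t2V := ounit_ideal (ounitV two_unit).
have [t20 _] := two_unit; have [d0 _] := delta_unit.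
(* The column [(alpha, beta, 1)] is the last column of [u(- bar beta, alpha)]. *)
have [beta eb] : exists beta, entry g 1 2 = beta * entry g 2 2.
  by exists (entry g 1 2 / entry g 2 2); rewrite divfK.
have [alpha ea] : exists alpha, entry g 0 2 = alpha * entry g 2 2.
  by exists (entry g 0 2 / entry g 2 2); rewrite divfK.
have beta0 : frac_ideal 0 beta.
  by apply: (ideal_mul_unit g22); rewrite mulrC -eb.
have alpha_e : frac_ideal e alpha.
  by apply: (ideal_mul_unit g22); rewrite mulrC -ea.
have alphaT : alpha + bar alpha = - (beta * bar beta).
  have := entry_herm g (isT : 2 < 3)%N (isT : 2 < 3)%N => /= h.
  have b220 : bar (entry g 2 2) != 0 by rewrite fmorph_eq0.
  apply: (mulfI (mulf_neq0 g220 b220)).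
  apply/eqP; rewrite -subr_eq0; apply/eqP; rewrite -[RHS]h ea eb !rmorphM /=.
  by ring.
have [i hi] := rx (- bar beta) Logic.I (idealN (bar_ideal beta0)).
(* [delta * b0] is the trace-zero part of [alpha]; the rest of [alpha] lies in
   [o_E], hence in [p_E^(d-m)]. *)
pose b0 := (alpha - bar alpha) / 2 / delta.
have b0_fixed : bar b0 = b0.
  rewrite /b0 !rmorphM !fmorphV rmorphB /= barK bar_delta rmorph_nat.
  by field; rewrite oppr_eq0 t20 d0.
have b0_e : frac_ideal e b0.
  apply: (@idealM _ e 0); first lia; last exact: ounit_ideal (ounitV delta_unit).
  apply: (@idealM _ e 0); [lia| |by []].
  by apply: idealB; [|exact: bar_ideal].
have [||j hj] := sb (w ^ (- e) * b0).
- by rewrite /= rmorphM bar_wz b0_fixed.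
- by apply/(ideal_uniformizer_mul _ _ _ uw); rewrite opprK; apply: idealW b0_e; lia.
exists i, j; have uK := Kn_cell i j.
set x := r i in hi uK *; set b := w ^ e * s j in uK *.
have bb : bar b = b by exact: s_fixed.
have x0 : frac_ideal 0 x by exact: r_ideal.
set h := (_ * _)%g; have hK : Kn bar m h by apply: KnM => //; exact: KnV.
have h22 : entry h 2 2 = entry g 2 2.
  by rewrite entryM !entry_sxV //= !mul0r !add0r mul1r.
have h12 : frac_ideal 1 (entry h 1 2).
  rewrite entryM !entry_sxV //= mul0r add0r mul1r.
  have -> : entry g 1 2 + bar x * entry g 2 2 =
      - (entry g 2 2 * bar (- bar beta - x)).
    by rewrite rmorphB rmorphN /= barK eb; ring.
  by apply: idealN; apply: idealM g22i (bar_ideal hi).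
have h02 : frac_ideal (d%:Z - m%:Z) (entry h 0 2).
  rewrite entryM !entry_sxV //= mul1r.
  have -> : entry g 0 2 + - x * entry g 1 2 +
      (- (x * bar x) / 2 - delta * b) * entry g 2 2 =
      entry g 2 2 * (delta * (b0 - b) - beta * bar beta / 2)
      - (x * entry g 1 2 + x * bar x / 2 * entry g 2 2).
    have -> : delta * (b0 - b) = (alpha - bar alpha) / 2 - delta * b.
      by rewrite /b0; field; rewrite ?t20 ?d0.
    have -> : bar alpha = - (beta * bar beta) - alpha.
      by rewrite -alphaT addrC addKr.
    by rewrite ea eb; field.
  apply: idealB.
    apply: (@idealM _ 0 (d%:Z - m%:Z)) => //; first lia.
    apply: idealB; last by apply: idealW (half_norm beta0); lia.
    apply: (@idealM _ 0 (d%:Z - m%:Z)); [lia|exact: ounit_ideal|].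
    rewrite -[b0](wzK e) /b -mulrBr; apply/(ideal_uniformizer_mul _ _ _ uw).
    by apply: idealW hj; lia.
  have hn := half_norm x0; have hx := x0.
  by apply: idealD; ideal_auto.
split=> //.
(* The remaining condition follows by orthogonality of the last two columns. *)
rewrite -[entry h 0 1]barK; apply: bar_ideal.
have := entry_herm h (isT : 1 < 3)%N (isT : 2 < 3)%N => /= hh.
rewrite -h22 in g22; apply: (ideal_mul_unit g22).
have [[_ _ _] [_ h11 _] [_ h21 _]] := hK.
have b21 := bar_ideal h21; have b11 := bar_ideal (ideal_unit_of_congr h11).
have -> : entry h 2 2 * bar (entry h 0 1) =
   - (bar (entry h 2 1) * entry h 0 2 + bar (entry h 1 1) * entry h 1 2).
  by apply/eqP; rewrite -addr_eq0 -[X in _ == X]hh; apply/eqP; ring.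
ideal_auto.
Qed.

(** The last column of [u^-1 * u'] compares the two classes separately: its middle
    entry sees [x], its top entry the trace-zero part. *)
Lemma cell_inj i j i' j' :
  Kcong m d ((sx (r i) (w ^ e * s j)%R)^-1 * sx (r i') (w ^ e * s j')%R)%g ->
  (i, j) = (i', j').
Proof.
move=> [_ _]; have [_ _ ri] := hr; have [_ _ sj] := hs.
rewrite !entryM !entry_sxV ?entry_sx //= !(mul0r, mulr0, mulr1, mul1r, add0r).
rewrite addrC => h1 h2.
have hx := r_ideal i; have hx' := r_ideal i'.
have e1 : i = i'.
  by apply: ri; rewrite -[_ - _]barK; apply: bar_ideal; rewrite rmorphB.
subst i'; congr (_, _); apply/esym/sj.
have : frac_ideal (d%:Z - m%:Z) (delta * (w ^ e * (s j' - s j))).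
  set y := (X in frac_ideal _ X) in h2.
  have -> : delta * (w ^ e * (s j' - s j)) = y.
    rewrite /y; have t20 : (2 : E) != 0 by case: two_unit.
    by field.
  by [].
move/(ideal_mul_unit delta_unit)/(ideal_uniformizer_mul _ _ _ uw).
by apply: idealW; lia.
Qed.

End OneCell.

Variables (IB IC : finType) (s : IB -> E) (s' : IC -> E).
Hypothesis hs : reps_mod [set x | bar x = x] d s.
Hypothesis hs' : reps_mod [set x | bar x = x] d.-1 s'.

(** The numbers of representatives for [d = 2] are [q ^ 4] and [q ^ 3], the sizes
    of the two parts of the Hecke sum. In the second cell the top entry lies in
    [p_E^(1-m)], which removes one digit. *)
Definition cells (i : IX * IB + IX * IC) : G :=
  match i with
  | inl ij => sx (r ij.1) (w ^ (- m%:Z) * s ij.2)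
  | inr ij => (t_ m * sx (r ij.1) (w ^ (1 - m%:Z) * s' ij.2)%R)%g
  end.

Let e1 : - m%:Z + d%:Z = d%:Z - m%:Z. Proof. lia. Qed.
Let e2 : (1 - m%:Z) + d.-1%:Z = d%:Z - m%:Z. Proof. lia. Qed.
Let l1 : - m%:Z <= - m%:Z. Proof. lia. Qed.
Let l2 : - m%:Z <= 1 - m%:Z. Proof. lia. Qed.

(** The last diagonal entry of the quotient would lie in [p_E]. *)
Let cells_disjoint ij i'j' :
  ~ Kcong m d ((cells (inl ij))^-1 * cells (inr i'j'))%g.
Proof.
move=> /(Kcong_unit hd); have [/(_ i'j'.2)[b b0] _ _] := hs'.
have [/(_ ij.2)[c c0] _ _] := hs.
have b' : bar (w ^ (1 - m%:Z) * s' i'j'.2) = w ^ (1 - m%:Z) * s' i'j'.2.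
  by rewrite rmorphM bar_wz b.
have c' : bar (w ^ (- m%:Z) * s ij.2) = w ^ (- m%:Z) * s ij.2.
  by rewrite rmorphM bar_wz c.
have [/(_ i'j'.1)[_ x0] _ _] := hr.
have Eu := entry_sxV (r ij.1) c'; have Eu' := entry_sx (r i'j'.1) b'.
rewrite /cells; set u := sx _ _ in Eu *; set u' := sx _ _ in Eu' *.
clearbody u u'; rewrite entryM Eu // Eu // Eu //= !(mul0r, mul1r, add0r).
rewrite entryM !entry_tg // Eu' // Eu' // Eu' //=.
rewrite !(mul0r, mul1r, mulr0, addr0, add0r) => /ounitNideal; apply.
apply/(ideal_uniformizer_mul _ _ _ uw); apply: ideal_sx02 => //; first by lia.
by apply/(ideal_uniformizer_mul _ _ _ uw); apply: idealW b0; lia.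
Qed.

(** Modulo [p_E] the last row of an element of [K_m] either has a unit in its
    last position, or acquires one when the cells are exchanged by [t_m]. *)
Lemma transversal_cells : transversal (Kn bar m) (Kcong m d) cells.
Proof.
split=> [[[i j]|[i j]]|g gK|[[i j]|[i j]] [[i' j']|[i' j']] h].
- exact: (Kn_cell l1 hs).
- by apply: KnM; [exact: Kn_tg|exact: (Kn_cell l2 hs')].
- have [u|/contrapT g22] := pselect (~ frac_ideal 1 (entry g 2 2)).
    have [[_ _ g02] _ [_ _ g22]] := gK.
    have [i [j h]] := cell_cover e1 l1 hs gK (ounitP g22 u) g02.
    by exists (inl (i, j)).
  have [[g00 _ g02] [g10 _ g12] [g20 _ _]] := gK.
  have tK : Kn bar m (t_ m * g)%g by apply: KnM => //; exact: Kn_tg.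
  have t22 : ounit (entry (t_ m * g)%g 2 2).
    apply: ounitP; first by case: tK => _ _ [].
    rewrite entryM !entry_tg //= !mul0r !addr0 => h.
    have hh : _ = 1 := entry_herm g (isT : 0 < 3)%N (isT : 2 < 3)%N.
    apply: (ounitNideal (ounit1 E)); rewrite -hh.
    have b00 := bar_ideal g00; have b10 := bar_ideal g10.
    have b20 := bar_ideal g20.
    move/(ideal_uniformizer_mul _ _ _ uw): h => h; clear g02.
    ideal_auto.
  have t02 : frac_ideal (1 - m%:Z) (entry (t_ m * g)%g 0 2).
    rewrite entryM !entry_tg //= !mul0r !add0r.
    by apply/(ideal_uniformizer_mul _ _ _ uw); apply: idealW g22; lia.
  have [i [j h]] := cell_cover e2 l2 hs' tK t22 t02.
  exists (inr (i, j)); rewrite /= invgM.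
  suff -> : (t_ m)^-1%g = t_ m by rewrite -mulgA.
  by apply/(mulgI (t_ m)); rewrite mulgV tgK.
- by congr inl; exact: (cell_inj e1 l1 hs h).
- by case: (cells_disjoint h).
- have {}h := KcongV bar_ideal h; rewrite invgM invgK in h.
  by case: (cells_disjoint h).
- congr inr; apply: (cell_inj e2 l2 hs').
  by move: h; rewrite /= invgM -mulgA mulKg.
Qed.

End Cells.

End Transversals.

(** * Sums over coset representatives *)

(** Left translation by [a] permutes the cosets of [H] in [A]. *)
Lemma sum_transversal_fixed (G : groupType) (K : nzRingType) (V : lmodType K)
    (pi : representation G V) (A H : set G) (I : finType) (s : I -> G) (v : V) :
  transversal A H s ->
  (forall g h, A g -> A h -> A (g * h)%g) ->
  (forall g h, H g -> H h -> H (g * h)%g) -> (forall g, H g -> H g^-1%g) ->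
  (forall h, H h -> pi h v = v) ->
  forall a, A a -> pi a (\sum_i pi (s i) v) = \sum_i pi (s i) v.
Proof.
move=> [sA sc si] AM HM HV vH a Aa.
have [f fP] := choice (fun i => sc _ (AM _ _ Aa (sA i))).
have f_inj : injective f.
  have e (x y z : G) : ((z * x)^-1 * (z * y) = x^-1 * y)%g.
    by rewrite invgM -mulgA mulKg.
  move=> i j fij; apply: si; have := HM _ _ (HV _ (fP i)) (fP j).
  by rewrite -fij !e.
rewrite linear_sum [RHS](reindex_inj f_inj); apply: eq_bigr => i _.
rewrite /= -ractionM -[X in pi X v](mulVKg (s (f i))) ractionM.
by congr (pi _ _); exact: vH (fP i).
Qed.

(** Distinct pieces may carry the same value [w i]; the integral groups them by
    value, and the measure of each group counts its pieces. *)
Lemma finite_integral_partition (R : realType) (T : ptopologicalType)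
    (V : lmodType R[i]) (mu : {measure set (borel T) -> \bar R}) (m : \bar R)
    (I : finType) (C : I -> set T) (D : set T) (f : T -> V) (w : I -> V) :
  D = \bigcup_i C i ->
  (forall i, @measurable _ (borel T) (C i)) ->
  (forall i, mu (C i) = m) -> m \is a fin_num -> (forall i, C i !=set0) ->
  (forall i j x, C i x -> C j x -> i = j) ->
  (forall i x, C i x -> f x = w i) ->
  finite_integral mu D f = \sum_i (fine m)%:C *: w i.
Proof.
move=> DE mC muC mfin C0 Cd fw; rewrite /finite_integral.
pose r := undup [seq w i | i : I].
have -> : f @` D = [set` r].
  apply/seteqP; split=> [y [x + <-]|y /=].
    by rewrite DE => -[i _ /fw ->] /=; rewrite mem_undup; exact: codom_f.
  rewrite mem_undup => /codomP[i ->]; have [x Cx] := C0 i.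
  by exists x; [rewrite DE; exists i|exact: fw Cx].
rewrite -fsbig_seq ?undup_uniq //.
have e y : mu (D `&` f @^-1` [set y]) = (\sum_(i | w i == y) m)%E.
  pose ry := [seq i <- index_enum I | w i == y].
  have -> : D `&` f @^-1` [set y] = \bigcup_(i in [set` ry]) C i.
    apply/seteqP; split=> x.
      rewrite DE => -[[i _ Cx]] /= fx; exists i => //=.
      by rewrite mem_filter mem_index_enum andbT -(fw _ _ Cx) fx eqxx.
    move=> [i /=]; rewrite mem_filter => /andP[/eqP wy _] Cx.
    by split; [rewrite DE; exists i|rewrite /= (fw _ _ Cx)].
  have tC : trivIset [set` ry] C.
    by move=> i j _ _ [x [Ci Cj]]; exact: Cd Ci Cj.
  rewrite (@measure_fin_bigcup _ _ (borel T) mu _ _ C (finite_seq _) tC) //.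
  rewrite -fsbig_seq ?filter_uniq ?index_enum_uniq // big_filter.
  by apply: eq_bigr => i _; exact: muC.
transitivity (\sum_(y <- r) \sum_(i | w i == y) (fine m)%:C *: w i).
  apply: eq_bigr => y _; rewrite e -[X in (\sum_(_ | _) X)%E](fineK mfin) sumEFin /=.
  rewrite rmorph_sum scaler_suml.
  by apply: eq_bigr => i /eqP ->.
rewrite (exchange_big_dep xpredT) //=; apply: eq_bigr => i _.
rewrite -big_filter (_ : [seq y <- r | w i == y] = [:: w i]) ?big_seq1 //.
rewrite (@eq_filter _ _ (pred1 (w i))); last by move=> y; rewrite /= eq_sym.
by rewrite filter_pred1_uniq ?undup_uniq // mem_undup codom_f.
Qed.

(** * The Hecke operator and the trace to a larger group *)

Section HeckeOperator.
Variables (E : localFieldType) (bar : {rmorphism E -> E}).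
Local Notation G := (U3 bar).
Implicit Types (g h : G) (m n d k : nat) (e : int) (x y b : E).
Hypothesis barK : involutive bar.
Hypothesis bar_ideal : forall (k : int) x, frac_ideal k x -> frac_ideal k (bar x).
Hypothesis two_unit : ounit (2 : E).
Variables (w delta : E).
Hypotheses (uw : uniformizer w) (bar_w : bar w = w).
Hypotheses (delta_unit : ounit delta) (bar_delta : bar delta = - delta).
Variable zeta : G.
Hypothesis zetaE : val zeta = mx3 w 0 0 0 1 0 0 0 w^-1.
Local Notation sx := (sx bar delta).

Let bar_wz e : bar (w ^ e) = w ^ e.
Proof. by rewrite fmorphXz bar_w. Qed.

Let w0 : w != 0. Proof. by case: uw. Qed.

(** [zeta] is the diagonal matrix with entries [w ^ wt i]. *)
Let wt (i : nat) : int := nth 0 [:: 1; 0; -1] i.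

Lemma entry_zeta i j : (i < 3)%N -> (j < 3)%N ->
  entry zeta i j = w ^ wt i *+ (i == j).
Proof.
move=> i3 j3; rewrite (entry_mx3 zetaE) //.
by case: i i3 => [|[|[|//]]] _; case: j j3 => [|[|[|//]]] _.
Qed.

Lemma entry_zetaV i j : (i < 3)%N -> (j < 3)%N ->
  entry zeta^-1%g i j = w ^ (- wt i) *+ (i == j).
Proof.
move=> i3 j3; rewrite entryV // entry_zeta //; try lia.
by case: i i3 => [|[|[|//]]] _; case: j j3 => [|[|[|//]]] _ /=;
  rewrite ?(rmorph0, rmorph1, mulr0n) // ?fmorphV /= ?bar_w.
Qed.

Lemma entry_conj_zeta g i j : (i < 3)%N -> (j < 3)%N ->
  entry (zeta^-1 * g * zeta)%g i j = w ^ (wt j - wt i) * entry g i j.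
Proof.
move=> i3 j3; rewrite [wt j - _]addrC expfzDr // [in RHS]mulrAC.
have e1 k : entry (zeta^-1 * g)%g i k = w ^ (- wt i) * entry g i k.
  rewrite entryM !entry_zetaV //.
  by case: i i3 {j3} => [|[|[|//]]] _ /=; rewrite !(mulr1n, mulr0n, mul0r, add0r, addr0).
rewrite entryM !e1 !entry_zeta //.
by case: j j3 => [|[|[|//]]] _ /=; rewrite !(mulr1n, mulr0n, mulr0, add0r, addr0).
Qed.

Lemma Kn_conj_zeta n g :
  Kn bar n g -> Kcong n 2 g <-> Kn bar n (zeta^-1 * g * zeta)%g.
Proof.
move=> gK; have [[g00 g01 g02] [g10 g11 g12] [g20 g21 g22]] := gK.
have iw (e k : int) x : frac_ideal (k - e) x -> frac_ideal k (w ^ e * x).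
  by move/(ideal_uniformizer_mul _ _ _ uw).
split=> [[_ h01 h12 h02]|[[_ h01 h02] [_ _ h12] _]].
  split; split; rewrite entry_conj_zeta //; try apply: iw.
  - by apply: idealW g00.
  - by apply: idealW h01.
  - by apply: idealW h02; rewrite /wt /=; lia.
  - by apply: idealW g10; rewrite /wt /=; lia.
  - by rewrite subrr expr0z mul1r.
  - by apply: idealW h12.
  - by apply: idealW g20; rewrite /wt /=; lia.
  - by apply: idealW g21; rewrite /wt /=; lia.
  - by apply: idealW g22.
rewrite !entry_conj_zeta // in h01 h02 h12.
split=> //.
- by move/(ideal_uniformizer_mul _ _ _ uw): h01; apply: idealW; rewrite /wt /=; lia.
- by move/(ideal_uniformizer_mul _ _ _ uw): h12; apply: idealW; rewrite /wt /=; lia.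
- by move/(ideal_uniformizer_mul _ _ _ uw): h02; apply: idealW; rewrite /wt /=; lia.
Qed.

Definition scalarg (z : E) : G := mxU3 bar z%:M.

Lemma val_scalarg z : z * bar z = 1 -> val (scalarg z) = z%:M.
Proof.
move=> zz; apply: val_mxU3; rewrite /unitary_mx.
rewrite map_scalar_mx tr_scalar_mx mul_scalar_mx mul_mx_scalar scalerA zz.
by rewrite scale1r.
Qed.

(** If [b] is the middle entry, [z = (1 + b) / (1 + bar b)] has norm one and
    [z - b] is a multiple of [1 - b * bar b], which unitarity makes small. *)
Lemma Kcong_conj_zeta m g : (0 < m)%N -> Kcong m 1 g ->
  exists z : E, exists h, [/\ z * bar z = 1, frac_ideal m%:Z (z - 1),
    Kn bar m.+1 h & (zeta^-1 * g * zeta = scalarg z * h)%g].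
Proof.
move=> m0 [gK h01 h12 h02]; have [[g00 g01 g02] [g10 g11 g12] [g20 g21 g22]] := gK.
pose b := entry g 1 1; rewrite -/b in g11.
have Nb : frac_ideal m.+1%:Z (1 - b * bar b).
  have hh : _ = 1 := entry_herm g (isT : 1 < 3)%N (isT : 1 < 3)%N.
  rewrite -{1}hh -/b (_ : forall p q r s : E, p + q * r + s - r * q = p + s);
    last by move=> *; ring.
  have b21 := bar_ideal g21; have b01 := bar_ideal h01.
  clear g01; ideal_auto.
have u1 : ounit (1 + b).
  apply: (ounit_congr two_unit); rewrite (_ : _ - _ = b - 1); last by ring.
  by apply: idealW g11; lia.
have u2 : ounit (1 + bar b).
  by rewrite -(rmorph1 bar) -rmorphD; exact: bar_ounit.
have [[n1 _] [n2 _]] := (u1, u2).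
pose z := (1 + b) / (1 + bar b).
have zz : z * bar z = 1.
  rewrite /z rmorphM fmorphV !rmorphD !rmorph1 /= barK.
  by field; rewrite n1 n2.
have zb : frac_ideal m.+1%:Z (z - b).
  have -> : z - b = (1 - b * bar b) * (1 + bar b)^-1 by rewrite /z; field.
  by apply: idealM Nb (ounit_ideal (ounitV u2)); lia.
have z1 : frac_ideal m%:Z (z - 1).
  rewrite -(subrKA b); apply: idealD => //; apply: idealW zb; lia.
exists z, ((scalarg z)^-1 * (zeta^-1 * g * zeta))%g; split=> //; last first.
  by rewrite mulVKg.
have z_0 : frac_ideal 0 (bar z) by apply/bar_ideal/(ideal_unit_of_congr z1).
have es g' i j : (i < 3)%N -> (j < 3)%N ->
    entry ((scalarg z)^-1 * g')%g i j = bar z * entry g' i j.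
  move=> i3 j3; have ez k l : (k < 3)%N -> (l < 3)%N ->
      entry (scalarg z)^-1%g k l = bar z *+ (k == l).
    move=> k3 l3; rewrite entryV // /entry val_scalarg // mxE -val_eqE /=.
    rewrite !inordK; try lia.
    have -> : (2 - l == 2 - k)%N = (k == l) by lia.
    by rewrite rmorphMn.
  rewrite entryM !ez //.
  by case: i i3 => [|[|[|//]]] _ /=; rewrite !(mulr1n, mulr0n, mul0r, add0r, addr0).
have iw (e k : int) x : frac_ideal (k - e) x -> frac_ideal k (bar z * (w ^ e * x)).
  move=> hx; apply: (@idealM _ 0 k) => //; first by rewrite add0r.
  exact/(ideal_uniformizer_mul _ _ _ uw).
split; split; rewrite es // entry_conj_zeta //.
- by apply: iw; apply: idealW g00.
- by apply: iw; apply: idealW h01.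
- by apply: iw; apply: idealW h02; rewrite /wt /=; lia.
- by apply: iw; apply: idealW g10; rewrite /wt /=; lia.
- rewrite subrr expr0z mul1r -/b -zz.
  have -> : bar z * b - z * bar z = - (bar z * (z - b)) by ring.
  by apply: idealN; apply: (@idealM _ 0 m.+1).
- by apply: iw; apply: idealW h12.
- by apply: iw; apply: idealW g20; rewrite /wt /=; lia.
- by apply: iw; apply: idealW g21; rewrite /wt /=; lia.
- by apply: iw; apply: idealW g22.
Qed.

(** The torus acts on the coordinate [x] of [U] by scaling; the other coordinate
    is invisible to [psi]. *)
Lemma torus_conj_sx (a : units E) x b : bar b = b ->
  exists y', y' + bar y' + val a * x * bar (val a * x) = 0 /\
  (torus bar a * sx x b = ug bar (val a * x)%R y' * torus bar a)%g.
Proof.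
move=> bb; have a0 := valP a.
have ba0 : bar (val a) != 0 by rewrite fmorph_eq0.
pose y := - (x * bar x) / 2 + delta * b.
have ey : y + bar y + x * bar x = 0 by exact: sx_herm.
exists (val a * bar (val a) * y).
have e : val a * bar (val a) * y + bar (val a * bar (val a) * y)
    + val a * x * bar (val a * x) = 0.
  transitivity (val a * bar (val a) * (y + bar y + x * bar x)).
    by rewrite !rmorphM /= barK; ring.
  by rewrite ey mulr0.
split=> //.
apply/val_inj; rewrite /= val_torus // !val_ug //.
apply/matrixP => i j; rewrite !mxE !big_ord_recl !big_ord0 !mxE.
case: i => [[|[|[|]]] //= ?]; case: j => [[|[|[|]]] //= ?];
  rewrite ?(mulr0, mul0r, mulr1, mul1r, addr0, add0r) //.
- by rewrite /y mulrAC mulfK // -mulrA.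
- by rewrite rmorphM /= mulNr mulrAC divff // mul1r.
Qed.

(** Both elements are antidiagonal, and their ratio is one step of the torus. *)
Lemma tg_zeta m : (tg bar w m.+1 * tg bar w m = zeta^-1)%g.
Proof.
apply: entryP => i j i3 j3; rewrite entryM !entry_tg // entry_zetaV //.
case: i i3 => [|[|[|//]]] _; case: j j3 => [|[|[|//]]] _;
  rewrite ?(mul0r, mulr0, add0r, addr0, mulr1, mulr1n, mulr0n) // -expfzDr //.
- by congr (w ^ _); rewrite /wt /=; lia.
- by congr (w ^ _); rewrite /wt /=; lia.
Qed.

Lemma sx_conj_zeta x b : bar b = b ->
  (zeta^-1 * sx x b * zeta = sx (w^-1 * x)%R (w ^ (-2) * b)%R)%g.
Proof.
move=> bb; have b2 : bar (w ^ (-2) * b) = w ^ (-2) * b.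
  by rewrite rmorphM bar_wz bb.
apply: entryP => i j i3 j3; rewrite entry_conj_zeta // !entry_sx //.
have e2 : w ^ (-2) = w^-1 * w^-1 by rewrite -(expfzDr (-1) (-1)).
case: i i3 => [|[|[|//]]] _; case: j j3 => [|[|[|//]]] _;
  rewrite /wt /= ?(mulr0, subrr, expr0z, mulr1) //.
- rewrite (_ : -1 - 1 = -2) // e2 rmorphM fmorphV /= bar_w.
  by ring.
- rewrite subr0 (_ : w ^ (-1) = w^-1) // rmorphM fmorphV /= bar_w.
  by rewrite mulrN.
Qed.

Section Representation.
Variables (R : realType) (V : lmodType R[i]) (pi : representation G V).
Variables (IX I2 I1 I0 : finType).
Variables (r : IX -> E) (s2 : I2 -> E) (s1 : I1 -> E) (s0 : I0 -> E).
Hypotheses (hr : reps_mod setT 1 r) (hs2 : reps_mod [set x | bar x = x] 2 s2)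
  (hs1 : reps_mod [set x | bar x = x] 1 s1)
  (hs0 : reps_mod [set x | bar x = x] 0 s0).

(** The sum is the trace of [pi zeta v] from [Kcong m 1] to [K_m], so it is fixed
    by [K_m]. That [Kcong m 1] fixes [pi zeta v] uses [Kcong_conj_zeta] and the
    triviality of the central character on [Z_m]. *)
Lemma trace_eq0 m (v : V) : (0 < m)%N ->
  fixed_by pi (Kn bar m.+1) v -> (forall u, fixed_by pi (Kn bar m) u -> u = 0) ->
  (forall z u, z * bar z = 1 -> frac_ideal m%:Z (z - 1) ->
     pi (scalarg z) u = u) ->
  \sum_i pi (cells bar w delta m r s1 s0 i) (pi zeta v) = 0.
Proof.
move=> m0 hv noK hz; apply: noK => a Aa.
have hm : (0 < 1 <= m)%N by [].
have T := transversal_cells barK bar_ideal two_unit uw bar_w delta_unit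
  bar_delta hm hr hs1 hs0.
apply: (sum_transversal_fixed T) Aa.
- by move=> g h; exact: KnM.
- by move=> g h; exact: KcongM.
- by move=> g; exact: KcongV.
move=> h /(Kcong_conj_zeta m0)[z [k [zz z1 kK e]]].
have -> : pi h (pi zeta v) = pi zeta (pi (zeta^-1 * h * zeta)%g v).
  by rewrite -!ractionM !mulgA mulgV mul1g.
by rewrite e ractionM hz // hv.
Qed.

(** The second cell of the Hecke sum is [t_(m+1)] applied to the first cell of the
    trace to [K_m]. As that trace is zero, it is minus [t_(m+1)] applied to the
    second cell, and [t_(m+1) * t_m = zeta^-1] turns this into a sum over
    [zeta^-1 * U * zeta] of translates of [v] itself. *)
Lemma hecke_sum_cells m (v : V) : (0 < m)%N ->
  fixed_by pi (Kn bar m.+1) v -> (forall u, fixed_by pi (Kn bar m) u -> u = 0) ->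
  (forall z u, z * bar z = 1 -> frac_ideal m%:Z (z - 1) ->
     pi (scalarg z) u = u) ->
  \sum_i pi (cells bar w delta m.+1 r s2 s1 i) (pi zeta v) =
  \sum_(ij : IX * I2) pi (sx (r ij.1) (w ^ (- m.+1%:Z) * s2 ij.2)) (pi zeta v) -
  \sum_(ij : IX * I0)
     pi (sx (w^-1 * r ij.1) (w ^ (-2) * (w ^ (1 - m%:Z) * s0 ij.2))) v.
Proof.
move=> m0 hv noK hz; have := trace_eq0 m0 hv noK hz.
rewrite !big_sumType /= => /eqP; rewrite addr_eq0 => /eqP T; congr (_ + _).
transitivity (pi (tg bar w m.+1)
   (\sum_(ij : IX * I1) pi (sx (r ij.1) (w ^ (- m%:Z) * s1 ij.2)) (pi zeta v))).
  rewrite linear_sum; apply: eq_bigr => ij _; rewrite -[RHS]ractionM.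
  by have -> : 1 - m.+1%:Z = - m%:Z by lia.
rewrite T linearN linear_sum -!sumrN; apply: eq_bigr => ij _; congr (- _).
have fx : bar (w ^ (1 - m%:Z) * s0 ij.2) = w ^ (1 - m%:Z) * s0 ij.2.
  by rewrite rmorphM bar_wz; have [/(_ ij.2)[-> _]] := hs0.
by rewrite -sx_conj_zeta // -!ractionM !mulgA tg_zeta.
Qed.

(** The double coset of [zeta] splits into the cosets [s i * zeta * K_n], all of
    volume [mu K_n] by left invariance. *)
Lemma hecke_op_cells (mu : {measure set (borel G) -> \bar R}) n (v : V) :
  (1 < n)%N -> fixed_by pi (Kn bar n) v ->
  mu (Kn bar n) \is a fin_num -> mu (Kn bar n) != 0%E ->
  (forall g, @measurable _ (borel G) [set (g * k)%g | k in Kn bar n]) ->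
  (forall g, mu [set (g * k)%g | k in Kn bar n] = mu (Kn bar n)) ->
  hecke_op pi mu zeta n v =
  \sum_i pi (cells bar w delta n r s2 s1 i) (pi zeta v).
Proof.
move=> n1 hv mfin m0 mK muK.
have hn : (0 < 2 <= n)%N by [].
have [sK sc si] := transversal_cells barK bar_ideal two_unit uw bar_w delta_unit
  bar_delta hn hr hs2 hs1.
set s := cells _ _ _ _ _ _ _ in sK sc si *.
pose C i : set G := [set (s i * zeta * k)%g | k in Kn bar n].
rewrite /hecke_op (@finite_integral_partition R G V mu (mu (Kn bar n)) _ C _ _
  (fun i => pi (s i) (pi zeta v))).
- rewrite scaler_sumr; apply: eq_bigr => i _; rewrite scalerA -rmorphM.
  by rewrite mulVf ?rmorph1 ?scale1r // fine_eq0.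
- apply/seteqP; split=> [_ [k1 [k2 [K1 K2 ->]]]|_ [i _ [k2 K2 <-]]]; last first.
    by exists (s i), k2.
  have [i h] := sc _ K1; exists i => //.
  exists (zeta^-1 * ((s i)^-1 * k1) * zeta * k2)%g.
    by apply: KnM => //; apply/Kn_conj_zeta => //; case: h.
  by rewrite !mulgA mulgK mulgV mul1g.
- by move=> i; exact: mK.
- by move=> i; exact: muK.
- by [].
- by move=> i; exists (s i * zeta * 1)%g, 1%g => //; exact: Kn1.
- move=> i j x [k K1 <-] [k' K2 e]; apply: si.
  have K3 : Kn bar n ((s i)^-1 * s j)%g by apply: KnM => //; exact: KnV.
  apply/(Kn_conj_zeta K3).
  have -> : (zeta^-1 * ((s i)^-1 * s j) * zeta = k * k'^-1)%g.
    apply: (mulIg k'); rewrite mulgVK; apply: (mulgI (s i * zeta)%g).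
    by rewrite -e !mulgA mulgK mulgV mul1g.
  by apply: KnM => //; exact: KnV.
- by move=> i x [k kK <-]; rewrite !ractionM hv.
Qed.

End Representation.

End HeckeOperator.

(** * The groups [K_n] are compact and open *)

Section LimitPoints.
Variable E : localFieldType.

Lemma ideal_all0 (x : E) : (forall t : int, frac_ideal t x) -> x = 0.
Proof.
move=> h; apply/eqP; apply: contraT => x0.
by have := ideal_ordv x0 (h (ordv x + 1)); lia.
Qed.

(** An ultrafilter is prime. *)
Lemma ultra_finite_cover (T : Type) (F : set_system T) (I : finType)
    (A : I -> set T) (B : set T) :
  UltraFilter F -> F B -> B `<=` \bigcup_i A i -> exists i, F (A i).
Proof.
move=> FU FB BA; apply: contrapT => /forallNP nA.
have : F [set x | forall i, (~` A i) x].
  by apply: filter_forall => i; have [/nA|//] := in_ultra_setVsetC (A i) FU.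
by move=> /(filterI FB)/filter_ex[x [/BA[i _ Aix] /(_ i)]].
Qed.

(** Compactness of the fractional ideals: at each level an ultrafilter selects
    one of finitely many classes, and completeness provides the common point. *)
Lemma ultra_limit (T : Type) (F : set_system T) (f : T -> E) (m : nat) :
  UltraFilter F -> F [set x | frac_ideal (- m%:Z) (f x)] ->
  exists l : E, forall t : int, F [set x | frac_ideal t (f x - l)].
Proof.
move=> FU Fm.
have [w w0 ow] := @ordv_normalized E; have uw : uniformizer w by [].
have Fproper := @ultra_proper _ F FU.
have hc (t : nat) : exists a : E, F [set x | frac_ideal t%:Z (f x - a)].
  have [I [r [_ [r0 rx _]]]] := reps_mod_exp E (t + m).
  pose A i := [set x | frac_ideal t%:Z (f x - w ^ (- m%:Z) * r i)].
  have [|i Ai] := @ultra_finite_cover T F I A _ FU Fm; last first.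
    by exists (w ^ (- m%:Z) * r i).
  move=> x fx; have [|i hi] := rx (w ^ m * f x) Logic.I.
    by apply/(ideal_uniformizer_mul _ _ _ uw); apply: idealW fx; lia.
  exists i => //=; rewrite /A /=.
  have -> : f x - w ^ (- m%:Z) * r i = w ^ (- m%:Z) * (w ^ m * f x - r i).
    by rewrite mulrBr mulrA -expfzDr // addNr expr0z mul1r.
  by apply/(ideal_uniformizer_mul _ _ _ uw); apply: idealW hi; lia.
have [a ha] := choice hc.
have aa (i j : nat) (n : int) : n <= i%:Z -> n <= j%:Z -> frac_ideal n (a i - a j).
  move=> ni nj; have [x [/= xi xj]] := filter_ex (filterI (ha i) (ha j)).
  apply: ideal_sub_trans; last exact: idealW xj.
  by apply: ideal_subC; apply: idealW xi.
have [n|l al] := @ordv_complete E a.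
  by exists `|n|%N => i j hi hj; apply: aa; lia.
exists l => t.
have nb : nbhs l [set y | frac_ideal t (y - l)].
  by apply/nbhs_ordv; exists t.
have [N _ hN] := al _ nb.
pose k := maxn N `|t|%N; apply: filterS (ha k) => x /= hx.
apply: ideal_sub_trans (hN k _); last by rewrite /= leq_maxl.
by apply: idealW hx; rewrite /k; lia.
Qed.

End LimitPoints.

Section Topology.
Variables (E : localFieldType) (bar : {rmorphism E -> E}).
Local Notation G := (U3 bar).
Implicit Types (g h : G) (n : nat).
Hypothesis barK : involutive bar.
Hypothesis bar_ideal : forall (k : int) x, frac_ideal k x -> frac_ideal k (bar x).

Let congr_mx (M : int) (x y : G) :=
  forall i j : 'I_3, frac_ideal M (val y i j - val x i j).

Lemma nbhs_U3P (x : G) (A : set G) :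
  nbhs x A <-> exists M : int, forall y, congr_mx M x y -> A y.
Proof.
split=> [|[M MA]].
  rewrite nbhsE => -[B [[U Uop <-] Ux] BA].
  have [P Px PU] : nbhs (val x) U by apply: open_nbhs_nbhs.
  have hP (ij : 'I_3 * 'I_3) : exists n : int,
      forall y, frac_ideal n (y - val x ij.1 ij.2) -> P ij.1 ij.2 y.
    exact/nbhs_ordv.
  have [f fP] := choice hP; exists (\sum_ij `|f ij|) => y yx; apply: BA; apply: PU.
  move=> i j; apply: (fP (i, j)); apply: idealW (yx i j).
  rewrite (bigD1 (i, j)) //=; apply: le_trans (ler_norm _) _.
  by rewrite lerDl sumr_ge0.
pose B := [set m : 'M[E]_3 | forall i j, frac_ideal M (m i j - val x i j)].
have hB : nbhs (val x) B.
  exists (fun i j => [set z | frac_ideal M (z - val x i j)]) => // i j.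
  by apply/nbhs_ordv; exists M.
have h : nbhs x (val @^-1` B).
  exact: (@initial_continuous _ _ (val : G -> 'M[E]_3) x B hB).
by apply: filterS h => y; exact: MA.
Qed.

Lemma entries_bounded g : exists M : int, forall i j, frac_ideal M (entry g i j).
Proof.
exists (- \sum_(ij : 'I_3 * 'I_3) `|ordv (val g ij.1 ij.2)|) => i j; right.
rewrite (bigD1 (inord i, inord j)) //= opprD -/(entry g i j).
have := ler_norm (- ordv (entry g i j)); rewrite normrN => h.
have : 0 <= \sum_(k : 'I_3 * 'I_3 | k != (inord i, inord j))
   `|ordv (val g k.1 k.2)| by rewrite sumr_ge0.
by set s := \sum_(_ | _) _; lia.
Qed.

Lemma Kn_congr n g h : Kn bar n g ->
  (forall i j, frac_ideal n%:Z (entry h i j - entry g i j)) -> Kn bar n h.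
Proof.
move=> [[g00 g01 g02] [g10 g11 g12] [g20 g21 g22]] gh.
have add k i j : k <= n%:Z -> frac_ideal k (entry g i j) ->
    frac_ideal k (entry h i j).
  move=> kn hg; rewrite -(subrK (entry g i j) (entry h i j)); apply: idealD => //.
  exact: idealW (gh i j).
split; split; try by (apply: add; first lia).
rewrite -(subrK (entry g 1 1) (entry h 1 1)) -addrA; exact: idealD.
Qed.

Lemma open_Kn_translate n g : open [set x | Kn bar n (g * x)%g].
Proof.
rewrite openE => x0 /= K0; apply/nbhs_U3P.
have [M gM] := entries_bounded g; exists (n%:Z - M) => x hx.
apply: (Kn_congr K0) => i j; rewrite !entryM.
have -> : forall a b c d e f d' e' f' : E,
    a * d + b * e + c * f - (a * d' + b * e' + c * f') =
    a * (d - d') + b * (e - e') + c * (f - f') by move=> *; ring.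
by do ![apply: idealD]; apply: (@idealM _ M (n%:Z - M)) => //; try exact: hx; lia.
Qed.

Lemma open_Kn n : open (Kn bar n).
Proof.
have := open_Kn_translate n 1%g; congr open.
by apply/seteqP; split=> x /=; rewrite mul1g.
Qed.

Let unitary_mxP (M : 'M[E]_3) :
  (forall i j : 'I_3, bar (M (inord 2) i) * M (inord 0) j
     + bar (M (inord 1) i) * M (inord 1) j + bar (M (inord 0) i) * M (inord 2) j
     = (i + j == 2)%N%:R) -> unitary_mx bar M.
Proof.
move=> h; apply/eqP/matrixP => i j.
by rewrite !mxE -h !U3_sum3 !mxE !U3_sum3 !mxE !inordK //=
  !(mulr0, mulr1, add0r, addr0).
Qed.

(** Entrywise limits along an ultrafilter exist by [ultra_limit]; the hermitian
    identity and membership in [K_n] pass to the limit, since both may be tested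
    modulo arbitrarily small ideals. *)
Lemma compact_Kn n : compact (Kn bar n).
Proof.
rewrite compact_ultra => F FU FK.
have Fproper := @ultra_proper _ F FU.
have Kb g : Kn bar n g -> forall i j, frac_ideal (- n%:Z) (val g i j).
  move=> [[g00 g01 g02] [g10 g11 g12] [g20 g21 g22]] i j.
  have g11' := ideal_unit_of_congr g11.
  have e : val g i j = entry g i j by rewrite /entry !inord_val.
  rewrite e; case: i {e} => [[|[|[|]]] //= _]; case: j => [[|[|[|]]] //= _];
    by match goal with h : frac_ideal _ ?x |- frac_ideal _ ?x =>
      apply: idealW h; lia end.
have hL (ij : 'I_3 * 'I_3) : exists l : E,
    forall t : int, F [set g : G | frac_ideal t (val g ij.1 ij.2 - l)].
  apply: (@ultra_limit E G F (fun g => val g ij.1 ij.2) n FU).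
  by apply: filterS FK => g /Kb; exact.
have [l hl] := choice hL; pose L := \matrix_(i, j) l (i, j).
have near t : exists2 g, Kn bar n g & forall i j, frac_ideal t (val g i j - L i j).
  have : F [set g : G | forall ij, frac_ideal t (val g ij.1 ij.2 - l ij)].
    by apply: filter_forall => ij; exact: hl.
  move=> /(filterI FK)/filter_ex[g [gK gL]]; exists g => // i j.
  by rewrite mxE; exact: gL (i, j).
have Lb i j : frac_ideal (- n%:Z) (L i j).
  have [g gK gL] := near (- n%:Z).
  rewrite -(subKr (val g i j) (L i j)).
  by apply: idealB; [exact: Kb|exact: gL].
have LU : unitary_mx bar L.
  apply: unitary_mxP => i j; apply/eqP; rewrite -subr_eq0; apply/eqP.
  apply: ideal_all0 => t.
  have [g gK gL] := near (t + n%:Z); have gb := Kb g gK.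
  have := entry_herm g (ltn_ord i) (ltn_ord j).
  rewrite /entry !inord_val => <-.
  have -> : forall a b c d e f a' b' c' d' e' f' : E,
    bar a * b + bar c * d + bar e * f - (bar a' * b' + bar c' * d' + bar e' * f')
    = - (bar (a' - a) * b' + bar a * (b' - b)
      + (bar (c' - c) * d' + bar c * (d' - d))
      + (bar (e' - e) * f' + bar e * (f' - f))).
    by move=> *; rewrite !rmorphB /=; ring.
  have lk k1 k2 k3 k4 : frac_ideal t (bar (val g k1 k2 - L k1 k2) * val g k3 k4).
    by apply: (@idealM _ (t + n%:Z) (- n%:Z)); [lia|exact: bar_ideal|].
  have lk' k1 k2 k3 k4 : frac_ideal t (bar (L k1 k2) * (val g k3 k4 - L k3 k4)).
    by apply: (@idealM _ (- n%:Z) (t + n%:Z)); [lia|exact: bar_ideal|].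
  by apply: idealN; do ![apply: idealD].
pose gL : G := Sub L LU.
exists gL; split.
  have [g gK hg] := near n%:Z; apply: (Kn_congr gK) => i j.
  by apply: ideal_subC; exact: hg.
move=> A /nbhs_U3P[M MA].
have : F [set g : G | forall ij, frac_ideal M (val g ij.1 ij.2 - l ij)].
  by apply: filter_forall => ij; exact: hl.
apply: filterS => g hg; apply: MA => i j.
by rewrite mxE; exact: hg (i, j).
Qed.

Lemma translate_KnE n g :
  [set (g * k)%g | k in Kn bar n] = [set x | Kn bar n (g^-1 * x)%g].
Proof.
apply/seteqP; split=> [_ [k kK <-]|x /= xK]; first by rewrite /= mulKg.
by exists (g^-1 * x)%g => //; rewrite mulVKg.
Qed.

Lemma measurable_translate_Kn n g :
  @measurable _ (borel G) [set (g * k)%g | k in Kn bar n].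
Proof.
by rewrite translate_KnE; apply: sub_sigma_algebra; exact: open_Kn_translate.
Qed.

Variables (R : realType) (mu : {measure set (borel G) -> \bar R}).
Hypothesis hmu : left_haar (fun g h : G => (g * h)%g) mu.

Lemma haar_Kn n : [/\ mu (Kn bar n) \is a fin_num, mu (Kn bar n) != 0%E
  & forall g, mu [set (g * k)%g | k in Kn bar n] = mu (Kn bar n)].
Proof.
have [hc ho hi] := hmu; split.
- by rewrite ge0_fin_numE //; apply: hc; exact: compact_Kn.
- rewrite gt_eqF //; apply: ho; first exact: open_Kn.
  by exists 1%g; exact: Kn1.
- move=> g; apply: hi; apply: sub_sigma_algebra; exact: open_Kn.
Qed.

End Topology.

(** * The recurrence for the Whittaker function *)

Section Whittaker.
Variables (E : localFieldType) (bar : {rmorphism E -> E}).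
Local Notation G := (U3 bar).
Implicit Types (n m : nat) (b c x : E) (a : units E).
Hypothesis barK : involutive bar.
Hypothesis bar_ideal : forall (k : int) x, frac_ideal k x -> frac_ideal k (bar x).
Hypothesis two_unit : ounit (2 : E).
Variables (w delta : E).
Hypotheses (uw : uniformizer w) (bar_w : bar w = w).
Hypotheses (delta_unit : ounit delta) (bar_delta : bar delta = - delta).
Local Notation sx := (sx bar delta).

Variables (R : realType) (psi : E -> R[i]).
Hypothesis hpsi : additive_char_conductor0 psi.

(** Otherwise [psi] would be trivial on the larger ideal [c * o_E]. *)
Lemma psi_nontrivial c : c != 0 -> ordv c < 0 ->
  exists2 x, frac_ideal 0 x & psi (c * x) != 1.
Proof.
move=> c0 oc; have [_ _ _ _ pc] := hpsi.
apply: contrapT => h; have hc : @frac_ideal E (ordv c) `<=` frac_ideal 0.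
  apply: pc => x xc; apply/eqP; apply: contraT => p1; case: h; exists (c^-1 * x).
    by apply: (@idealM _ (- ordv c) (ordv c)); [lia|right; rewrite ordvV|].
  by rewrite mulVKf.
have : frac_ideal (ordv c) c by right.
by move/hc/(ideal_ordv c0); lia.
Qed.

Lemma psi_integral x : frac_ideal 0 x -> psi x = 1.
Proof. by have [_ _ _ h _] := hpsi; exact: h. Qed.

(** Translation by a suitable [x] permutes the classes and multiplies the sum by
    [psi (c * x)], which is not [1]. *)
Lemma psi_sum0 (IX : finType) (r : IX -> E) c :
  reps_mod setT 1 r -> c != 0 -> ordv c = - 1 -> \sum_i psi (c * r i) = 0.
Proof.
move=> [r0 rx ri] c0 oc; have [|x x0 px] := psi_nontrivial c0; first by rewrite oc.
have [_ pD _ _ _] := hpsi.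
have [f fP] := choice (fun i => rx (r i + x) Logic.I (idealD (r0 i).2 x0)).
have f_inj : injective f.
  move=> i j fij; apply: ri.
  have := fP j; rewrite -fij => /ideal_subC/(ideal_sub_trans (fP i)).
  by rewrite opprD addrACA subrr addr0.
set s := \sum_i _; have e : psi (c * x) * s = s.
  rewrite {2}/s (reindex_inj f_inj) mulr_sumr; apply: eq_bigr => i _.
  rewrite -pD; apply: esym; rewrite -[RHS]mul1r.
  have <- : psi (c * (r (f i) - (r i + x))) = 1.
    apply: psi_integral; apply: (@idealM _ (-1) 1) => //; first by right; rewrite oc.
    exact: ideal_subC.
  by rewrite -pD; congr (psi _); ring.
apply/eqP; move/eqP: e; rewrite -subr_eq0 -[X in _ - X]mul1r -mulrBl mulf_eq0.
by rewrite subr_eq0 (negPf px).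
Qed.

Lemma torusM a a' : torus bar (a * a')%g = (torus bar a * torus bar a')%g.
Proof.
have aE := val_torus barK; apply/val_inj; rewrite /= !aE.
apply/matrixP => i j; rewrite !mxE !big_ord_recl !big_ord0 !mxE.
by case: i => [[|[|[|]]] //= ?]; case: j => [[|[|[|]]] //= ?];
  rewrite ?(mulr0, mul0r, mulr1, mul1r, addr0, add0r) // rmorphM invfM.
Qed.

Lemma torus1 : torus bar 1%g = 1%g.
Proof.
by apply: (mulgI (torus bar 1%g)); rewrite -torusM !mulg1.
Qed.

Lemma Kn_torus n a : ordv (val a) = 0 -> Kn bar n (torus bar a).
Proof.
move=> oa; have ua : ounit (val a) by split=> //; exact: (valP a).
have h := entry_mx3 (val_torus barK a).
split; split; rewrite h //=; try exact: ideal0.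
- exact: ounit_ideal.
- by rewrite subrr; left.
- by apply/ounit_ideal/ounitV/bar_ounit.
Qed.

Variables (V : lmodType R[i]) (pi : representation G V) (l : {scalar V}).
Hypothesis hl : whittaker_functional pi psi l.

Lemma whittaker_sx a x b (u : V) : bar b = b ->
  l (pi (torus bar a) (pi (sx x b) u)) =
  psi (val a * x) * l (pi (torus bar a) u).
Proof.
move=> bb; have [y [ey e]] :=
  torus_conj_sx barK two_unit bar_delta a x bb.
by rewrite -ractionM e ractionM (hl (val_ug barK ey)).
Qed.

Section Recurrence.
Variables (zeta : G) (zetaE : val zeta = mx3 w 0 0 0 1 0 0 0 w^-1).
Variables (m : nat) (v : V).
Hypothesis hv : fixed_by pi (Kn bar m.+1) v.

Local Notation c_ a := (l (pi (torus bar a) v)).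

(** [u(x, y)] fixes [v] for integral [x], while on the left it acts through
    [psi (a * x)]. *)
Lemma whittaker_neg a : ordv (val a) < 0 -> c_ a = 0.
Proof.
move=> oa; have [x x0 px] := psi_nontrivial (valP a) oa.
have b0 : bar 0 = 0 by rewrite rmorph0.
have K : Kn bar m.+1 (sx x 0) by apply: Kn_sx => //; exact: ideal0.
have := whittaker_sx a x v b0; rewrite hv // => /eqP.
rewrite -subr_eq0 -{1}[c_ a]mul1r -mulrBl mulf_eq0 subr_eq0 eq_sym (negPf px).
by move/eqP.
Qed.

Lemma whittaker_unit a a' : ordv (val a) = ordv (val a') -> c_ a = c_ a'.
Proof.
move=> e; rewrite -[in LHS](mulVKg a' a) torusM ractionM hv //.
apply: Kn_torus; rewrite /= ordvM ?invr_eq0 ?ordvV ?(valP a) ?(valP a') //.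
by rewrite -[RHS](addNr (ordv (val a'))); congr (_ + _).
Qed.

Let w0 : w != 0. Proof. by case: uw. Qed.
Definition uniformizer_unit : units E := Sub w w0.

Lemma torus_uniformizer : torus bar uniformizer_unit = zeta.
Proof. by apply/val_inj; rewrite val_torus //= zetaE /tmx bar_w. Qed.

Variables (IX I2 I1 I0 : finType).
Variables (r : IX -> E) (s2 : I2 -> E) (s1 : I1 -> E) (s0 : I0 -> E).
Hypotheses (hr : reps_mod setT 1 r) (hs2 : reps_mod [set x | bar x = x] 2 s2)
  (hs1 : reps_mod [set x | bar x = x] 1 s1)
  (hs0 : reps_mod [set x | bar x = x] 0 s0).

Hypothesis m0 : (0 < m)%N.
Hypothesis noK : forall u, fixed_by pi (Kn bar m) u -> u = 0.
Hypothesis hz : forall z u, z * bar z = 1 -> frac_ideal m%:Z (z - 1) ->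
  pi (scalarg bar z) u = u.
Variable lambda : R[i].
Hypothesis hT :
  \sum_i pi (cells bar w delta m.+1 r s2 s1 i) (pi zeta v) = lambda *: v.

Let bar_fixed (I : finType) (k : int) (s : I -> E) (e : int) i :
  reps_mod [set x | bar x = x] k s -> bar (w ^ e * s i) = w ^ e * s i.
Proof.
by case=> /(_ i)[si _] _ _; rewrite rmorphM fmorphXz bar_w si.
Qed.

(** The eigenvalue equation read off at [a]. On the first cell [psi] is evaluated
    at integral points; on the second one, at points of [a * w^-1 * o_E]. *)
Lemma hecke_coefficient a : 0 <= ordv (val a) ->
  lambda * c_ a = (#|IX| * #|I2|)%:R * c_ (a * uniformizer_unit)%g
    - (\sum_i psi (val a * w^-1 * r i)) * (#|I0|%:R * c_ a).
Proof.
move=> a0; have r0 i : frac_ideal 0 (r i) by have [/(_ i)[]] := hr.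
have e := hecke_sum_cells barK bar_ideal two_unit uw bar_w delta_unit bar_delta
  zetaE s2 hr hs1 hs0 m0 hv noK hz.
have -> : lambda * c_ a = l (pi (torus bar a) (lambda *: v)) by rewrite !linearZ.
rewrite -hT e !linearB !linear_sum sumrN /=; congr (_ - _).
  rewrite -card_prod -sum1_card natr_sum mulr_suml; apply: eq_bigr => -[i j] _ /=.
  rewrite whittaker_sx ?(bar_fixed _ _ hs2) // psi_integral; last first.
    by apply: (@idealM _ 0 0) => //; right.
  by rewrite torusM ractionM torus_uniformizer.
rewrite mulr_suml.
rewrite -(pair_bigA _ (fun i j => l (pi (torus bar a)
     (pi (sx (w^-1 * r i) (w ^ (-2) * (w ^ (1 - m%:Z) * s0 j))) v)))) /=.
apply: eq_bigr => i _; rewrite -sum1_card natr_sum mulr_suml mulr_sumr.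
apply: eq_bigr => j _; rewrite whittaker_sx ?mulrA ?mulr1 //.
by rewrite -mulrA rmorphM (bar_fixed _ _ hs0) fmorphXz bar_w.
Qed.

(** The character sum of [hecke_coefficient] is [#|IX|] when [a * w^-1] is
    integral and [0] when [a] is a unit; this is where the first step of the
    recurrence differs from the others. *)
Lemma whittaker_recurrence :
  exists c : nat -> R[i], [/\ c 0%N = l v,
    forall (i : nat) a, ordv (val a) = i -> c_ a = c i,
    lambda * c 0%N = (#|IX| * #|I2|)%:R * c 1%N
  & forall i, lambda * c i.+1 = (#|IX| * #|I2|)%:R * c i.+2
                                - (#|IX| * #|I0|)%:R * c i.+1].
Proof.
have ow := uw.2.
have oX (i : nat) : ordv (val (uniformizer_unit ^+ i)%g) = i.
  elim: i => [|i IH]; first by rewrite expg0 /= ordv1.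
  by rewrite expgS /= ordvM ?(valP (_ : units E)) // IH ow; lia.
exists (fun i => c_ (uniformizer_unit ^+ i)%g); split.
- by rewrite expg0 torus1 raction1.
- by move=> i a oa; apply: whittaker_unit; rewrite oX.
- rewrite hecke_coefficient ?oX // -expgSr psi_sum0 ?mul0r ?subr0 //.
    by rewrite mulf_neq0 ?invr_eq0 ?(valP (_ : units E)).
  by rewrite ordvM ?invr_eq0 ?(valP (_ : units E)) // oX ordvV // ow.
- move=> i; rewrite hecke_coefficient ?oX // -expgSr; congr (_ - _).
  rewrite natrM -mulrA; congr (_ * _); rewrite -sum1_card natr_sum.
  apply: eq_bigr => j _; apply: psi_integral.
  have [/(_ j)[_ rj] _ _] := hr.
  apply: (@idealM _ 0 0) => //; right.
  by rewrite ordvM ?invr_eq0 ?(valP (_ : units E)) // oX ordvV // ow; lia.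
Qed.

End Recurrence.

End Whittaker.

(** * Integrals of functions of the valuation *)

Section ShellIntegral.
Import numFieldNormedType.Exports.
Variables (R : realType) (E : localFieldType).
Variable nu : {measure set (borel (units E)) -> \bar R}.
Hypothesis hnu : left_haar (fun a b : units E => (a * b)%g) nu.
Hypothesis hnu1 : nu [set a : units E | ordv (val a) = 0] = 1%E.
Implicit Types a : units E.

Lemma ordv_locally_constant (x y : E) :
  x != 0 -> y != 0 -> frac_ideal (ordv x + 1) (y - x) -> ordv y = ordv x.
Proof.
move=> x0 y0 yx; have [_] : ounit (y / x).
  apply: (ounit_congr (ounit1 E)).
  have -> : y / x - 1 = (y - x) * x^-1 by rewrite mulrBl divff.
  by apply: idealM yx _; last (right; rewrite ordvV //); lia.
by rewrite ordvM ?invr_eq0 // ordvV // => /eqP; rewrite subr_eq0 => /eqP.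
Qed.

Lemma open_ordv (P : int -> Prop) : open [set a : units E | P (ordv (val a))].
Proof.
rewrite openE => a /= Pa.
pose B := [set x : E | frac_ideal (ordv (val a) + 1) (x - val a)].
have hB : nbhs (val a) B by apply/nbhs_ordv; exists (ordv (val a) + 1).
have h : nbhs a (val @^-1` B).
  exact: (@initial_continuous _ _ (val : units E -> E) a B hB).
apply: filterS h => b /= ab.
by rewrite (ordv_locally_constant (valP a) (valP b) ab).
Qed.

Lemma measurable_ordv (P : int -> Prop) :
  @measurable _ (borel (units E)) [set a | P (ordv (val a))].
Proof. by apply: sub_sigma_algebra; exact: open_ordv. Qed.

Lemma shell_measure (i : int) : nu [set a | ordv (val a) = i] = 1%E.
Proof.
have [w w0 ow] := @ordv_normalized E.
have wi0 : w ^ i != 0 by rewrite expfz_neq0.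
pose u : units E := Sub (w ^ i) wi0.
have ou : ordv (val u) = i by rewrite /= ordvXz // ow mul1r.
have [_ _ hi] := hnu.
rewrite -hnu1 -[in RHS](hi u); last exact: (measurable_ordv (fun k => k = 0)).
congr (nu _); apply/seteqP; split=> [a /= oa|_ [b /= ob <-]].
  exists (u^-1 * a)%g; last by rewrite mulVKg.
  by rewrite /= ordvM ?invr_eq0 ?(valP a) // ordvV // ordvXz // ow oa; lia.
by rewrite /= ordvM ?(valP b) // [ordv (w ^ i)]ou ob addr0.
Qed.

(** Integration of a function of the valuation: the shells have measure one, so
    the integral is the sum of a series. *)
Lemma shell_integral (g : units E -> R) (h : nat -> R) (C rho S : R) :
  (forall a, ordv (val a) < 0 -> g a = 0) ->
  (forall (i : nat) a, ordv (val a) = i -> g a = h i) ->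
  0 <= rho < 1 -> (forall i, `|h i| <= C * rho ^+ i) ->
  \sum_(i < n) h i @[n --> \oo] --> S ->
  nu.-integrable setT (fun a : borel (units E) => (g a)%:E) /\
  Rintegral nu setT (fun a : borel (units E) => g a) = S.
Proof.
move=> gneg gh /andP[rho0 rho1] hb hS.
(* Index [0] collects negative valuations, where [g] vanishes. *)
pose sh (k : nat) : set (borel (units E)) :=
  [set a | if k is i.+1 then ordv (val (a : units E)) = i
           else ordv (val (a : units E)) < 0].
have msh k : measurable (sh k).
  by case: k => [|i]; [exact: (measurable_ordv (fun k => k < 0))
                      |exact: (measurable_ordv (fun k => k = i))].
have ush : \bigcup_k sh k = setT.
  apply/seteqP; split=> // a _; have [a0|a0] := ltP (ordv (val (a : units E))) 0.
    by exists 0%N.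
  by exists (`|ordv (val (a : units E))|%N.+1) => //=; rewrite gez0_abs.
have tsh : trivIset setT sh.
  by move=> [|i] [|j] _ _ [a [/= h1 h2]] //; move: h1; rewrite ?h2; lia.
have mg0 : @measurable_fun _ _ (borel (units E)) (measurableTypeR R) setT g.
  move=> _ A mA; rewrite setTI; apply: sub_sigma_algebra.
  rewrite (_ : _ @^-1` _ = [set a : units E | [set k : int |
      if k is Posz i then A (h i) else A 0] (ordv (val a))]).
    exact: open_ordv.
  apply/seteqP; split=> a /=; case oa : (ordv (val a)) => [i|i].
  - by rewrite (gh i).
  - by rewrite gneg // oa.
  - by rewrite (gh i).
  - by rewrite gneg // oa.
have mg : measurable_fun setT (fun a : borel (units E) => (g a)%:E).
  exact/measurable_EFinP.
have ish (f : R -> R) k : f 0 = 0 -> (\int[nu]_(a in sh k) (f (g a))%:E =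
    (if k is i.+1 then f (h i) else 0)%:E)%E.
  move=> f0; case: k => [|i].
    by rewrite integral0_eq // => a /= a0; rewrite gneg ?f0.
  rewrite (eq_integral (cst (f (h i))%:E)) ?integral_cst //.
    by rewrite (shell_measure i) mule1.
  by move=> a; rewrite inE /= => oa; rewrite (gh i).
have gi : nu.-integrable setT (fun a : borel (units E) => (g a)%:E).
  apply/integrableP; split=> //.
  rewrite -ush ge0_integral_bigcup //=; last first.
    by rewrite ush; exact: (measurableT_comp (@abse_measurable R setT) mg).
  apply: (@le_lt_trans _ _ (C * (1 - rho)^-1)%:E); last exact: ltry.
  apply: lime_le.
    by apply: is_cvg_nneseries => n _ _; exact: integral_ge0.
  apply: nearW => n; rewrite (eq_bigr (fun k =>
      (if k is i.+1 then `|h i| else 0)%:E)); last first.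
    by move=> k _; rewrite (ish (fun y => `|y|)) ?normr0 //; case: k.
  rewrite sumEFin lee_fin.
  have C0 : 0 <= C by have := hb 0%N; rewrite expr0 mulr1; exact: le_trans.
  have geo k : \sum_(i < k) rho ^+ i <= (1 - rho)^-1.
    rewrite -[leRHS]mul1r ler_pdivlMr ?subr_gt0 // mulrC.
    by rewrite -[1 - rho]opprB mulNr -subrX1 opprB gerBl exprn_ge0.
  case: n => [|n]; first by rewrite big_nil mulr_ge0 // invr_ge0 subr_ge0 ltW.
  rewrite big_nat_recl //= add0r big_mkord.
  apply: (@le_trans _ _ (C * \sum_(i < n) rho ^+ i)).
    by rewrite mulr_sumr; apply: ler_sum => i _; exact: hb.
  by apply: ler_wpM2l.
split=> //; rewrite /Rintegral -ush integral_bigcup //; last by rewrite ush.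
have -> : (\big[+%E/0]_(0 <= i <oo) (\int[nu]_(x in sh i) (g x)%:E) = S%:E)%E.
  apply: cvg_lim => //; rewrite -(cvg_shiftS _).
  apply: (@cvg_trans _ ((\sum_(i < n) h i)%:E @[n --> \oo])).
    apply: near_eq_cvg; apply: nearW => n /=.
    rewrite big_nat_recl // (ish id) // add0e big_mkord -sumEFin.
    by apply: eq_bigr => i _; rewrite (ish id).
  by apply: cvg_EFin; [exact: nearW|exact: hS].
by [].
Qed.

End ShellIntegral.

(** * The zeta integral as a geometric series *)

Section ZetaIntegral.
Import numFieldNormedType.Exports.
Variable R : realType.
Local Notation C := R[i].
Local Notation nm := (@Normc.normc R).
Implicit Types (s t z : C) (x y : R).

Let nmE z : nm z = Num.sqrt (complex.Re z ^+ 2 + complex.Im z ^+ 2).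
Proof. by case: z. Qed.

Let nm_ge0 z : 0 <= nm z. Proof. by rewrite nmE sqrtr_ge0. Qed.

Let nmX z (n : nat) : nm (z ^+ n) = nm z ^+ n.
Proof.
elim: n => [|n IH]; first by rewrite !expr0 Normc.normc1.
by rewrite !exprS Normc.normcM IH.
Qed.

Lemma Re_le_normc z : `|complex.Re z| <= nm z.
Proof. by rewrite nmE -sqrtr_sqr ler_sqrt ?addr_ge0 ?sqr_ge0 // lerDl sqr_ge0. Qed.

Lemma Im_le_normc z : `|complex.Im z| <= nm z.
Proof. by rewrite nmE -sqrtr_sqr ler_sqrt ?addr_ge0 ?sqr_ge0 // lerDr sqr_ge0. Qed.

Let cis x : C := cos x +i* sin x.

Let cisD x y : cis (x + y) = cis x * cis y.
Proof. by rewrite /cis cosD sinD; apply/eqP; rewrite eq_complex /= eqxx addrC eqxx. Qed.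

Let cis0 : cis 0 = 1.
Proof. by rewrite /cis cos0 sin0. Qed.

Lemma cpowM x y s : 0 < x -> 0 < y -> cpow (x * y) s = cpow x s * cpow y s.
Proof.
move=> x0 y0; rewrite /cpow powRM ?ltW // lnM ?posrE // mulrDr -/(cis _) cisD.
by rewrite rmorphM /= mulrACA.
Qed.

Lemma cpow1 s : cpow 1 s = 1.
Proof. by rewrite /cpow powR1 ln1 mulr0 -/(cis _) cis0 mulr1. Qed.

Lemma cpowX x s (n : nat) : 0 < x -> cpow (x ^+ n) s = cpow x s ^+ n.
Proof.
move=> x0; elim: n => [|n IH]; first by rewrite !expr0 cpow1.
by rewrite !exprS cpowM ?exprn_gt0 // IH.
Qed.

Lemma cpowD x s t : 0 < x -> cpow x (s + t) = cpow x s * cpow x t.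
Proof.
move=> x0; rewrite /cpow !raddfD /= powRD; last by rewrite (gt_eqF x0) implybT.
by rewrite mulrDl -!/(cis _) cisD rmorphM mulrACA.
Qed.

Lemma cpowV x s : 0 < x -> cpow x^-1 s = cpow x (- s).
Proof.
move=> x0; rewrite /cpow lnV ?posrE // !raddfN /= mulNr mulrN.
by rewrite -powR_inv1 ?ltW // -powRrM mulN1r.
Qed.

Lemma cpow_nat x (n : nat) : 0 < x -> cpow x n%:R = (x ^+ n)%:C.
Proof.
move=> x0; have e : (n%:R : C) = (n%:R)%:C by rewrite rmorph_nat.
by rewrite /cpow e /= mul0r -/(cis _) cis0 mulr1 powR_mulrn ?ltW.
Qed.

Lemma normc_cpow x s : 0 < x -> nm (cpow x s) = x `^ complex.Re s.
Proof.
move=> x0; rewrite /cpow Normc.normcM !nmE /= expr0n addr0 cos2Dsin2 sqrtr1 mulr1.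
by rewrite sqrtr_sqr ger0_norm // powR_ge0.
Qed.

(** The shape of the zeta series: the first term does not belong to the geometric
    progression, which produces the numerator [1 - 'X]. *)
Let term (a d z : C) (i : nat) : C := if i is j.+1 then d * z ^+ j else a.

Let term_bound (a d z : C) : nm z < 1 -> exists M rho : R,
  0 <= rho < 1 /\ forall i, nm (term a d z i) <= M * rho ^+ i.
Proof.
move=> z1.
(* [nm z] may vanish, so it cannot serve as the ratio itself. *)
pose rho := (nm z + 1) / 2.
have h0 := nm_ge0 z; have rho0 : 0 < rho by rewrite /rho; lra.
have zr : nm z <= rho by rewrite /rho; lra.
exists (nm a + nm d / rho), rho; split; first by rewrite /rho; apply/andP; split; lra.
case=> [|i] /=; first by rewrite expr0 mulr1 lerDl mulr_ge0 // invr_ge0 ltW.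
rewrite Normc.normcM nmX mulrDl exprS [nm d / rho * _]mulrA divfK ?gt_eqF //.
have r0 := ltW rho0; apply: ler_wpDl.
  by apply: mulr_ge0 => //; apply: mulr_ge0 => //; exact: exprn_ge0.
by apply: ler_wpM2l => //; rewrite lerXn2r ?nnegrE // ltW.
Qed.

Let term_sum (a d z : C) (n : nat) : z != 1 ->
  \sum_(i < n.+1) term a d z i = a + d / (1 - z) - d / (1 - z) * z ^+ n.
Proof.
move=> z1; rewrite big_ord_recl /= -mulr_sumr -addrA; congr (_ + _).
have z10 : 1 - z != 0 by rewrite subr_eq0 eq_sym.
have e := subrX1 z n.
apply: (mulfI z10); rewrite mulrCA -[1 - z]opprB mulNr -e.
by field; rewrite -opprB oppr_eq0.
Qed.

Let term_cvg (p : {additive C -> R}) (a d z : C) :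
  (forall t, `|p t| <= nm t) -> nm z < 1 ->
  \sum_(i < n) p (term a d z i) @[n --> \oo] --> p (a + d / (1 - z)).
Proof.
move=> hp z1.
have zn1 : z != 1 by apply/eqP => e; move: z1; rewrite e Normc.normc1 ltxx.
rewrite -(cvg_shiftS _) /=.
pose e n := p (d / (1 - z) * z ^+ n).
have e0 : e @ \oo --> (0 : R).
  apply: norm_cvg0; apply: (@squeeze_cvgr _ _ _ _ (fun=> 0)
    (fun n => nm (d / (1 - z)) * nm z ^+ n)); last 2 first.
  - exact: cvg_cst.
  - rewrite -(mulr0 (nm (d / (1 - z)))); apply: cvgM; first exact: cvg_cst.
    by apply: cvg_expr; rewrite ger0_norm.
  apply: nearW => n; rewrite normr_ge0 /=.
  by have := hp (d / (1 - z) * z ^+ n); rewrite Normc.normcM nmX.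
have -> : (fun n => \sum_(i < n.+1) p (term a d z i)) =
          (fun n => p (a + d / (1 - z)) - e n).
  by apply/funext => n; rewrite -raddf_sum term_sum // raddfB.
have := cvgB (cvg_cst (p (a + d / (1 - z)))) e0.
by rewrite subr0; exact.
Qed.

Variables (E : localFieldType) (bar : {rmorphism E -> E}).
Variable nu : {measure set (borel (units E)) -> \bar R}.
Hypothesis hnu : left_haar (fun a b : units E => (a * b)%g) nu.
Hypothesis hnu1 : nu [set a : units E | ordv (val a) = 0] = 1%E.
Variable q : nat.
Hypotheses (q1 : (1 < q)%N) (qE : residue_card E = (q ^ 2)%N).

Let q0 : 0 < (q%:R : R). Proof. by rewrite ltr0n; lia. Qed.

Let norm_val_cpow (i : nat) (a : units E) s : ordv (val a) = i ->
  cpow (norm_val R (val a)) (s - 1) = (q%:R ^+ 2 * cpow q%:R (- (2 * s))) ^+ i.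
Proof.
move=> oa; rewrite /norm_val (negPf (valP a)) oa qE natrX.
have -> : (q%:R ^+ 2 : R) ^ (- i%:Z) = ((q%:R ^+ 2)^-1) ^+ i.
  by rewrite -exprnN exprVn.
rewrite cpowX ?invr_gt0 ?exprn_gt0 //; congr (_ ^+ _).
rewrite cpowV ?exprn_gt0 // cpowX // expr2 -cpowD //.
have -> : - (s - 1) + - (s - 1) = 2%:R + - (2 * s) by ring.
by rewrite cpowD // cpow_nat // rmorphXn /= rmorph_nat.
Qed.

Lemma is_zeta_integral_geometric (W : U3 bar -> C) (c : nat -> C) (alpha : C) :
  (forall a, ordv (val a) < 0 -> W (torus bar a) = 0) ->
  (forall (i : nat) a, ordv (val a) = i -> W (torus bar a) = c i) ->
  q%:R ^+ 2 * c 1%N = (alpha - 1) * c 0%N ->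
  (forall i, q%:R ^+ 2 * c i.+2 = alpha * c i.+1) ->
  is_zeta_integral nu q W
    ((1 - 'X)%:F / (1 - alpha *: 'X)%:F * ((c 0%N)%:P)%:F).
Proof.
move=> Wneg Wc c1 cS.
exists ((1 - 'X) * (c 0%N)%:P), (1 - alpha *: 'X); split.
- apply/eqP => /(congr1 (fun P : {poly C} => P.[0])).
  by rewrite !hornerE ?mulr0 ?subr0 => /eqP; rewrite oner_eq0.
- by rewrite tofracM mulrAC.
(* [nm X] is [q `^ (- 2 * Re s)], so this abscissa gives
   [nm X * (nm alpha + 1) < 1]. *)
exists (ln (nm alpha + 1) / (2 * ln q%:R)) => s hs integrand X.
have lnq : 0 < ln (q%:R : R) by rewrite ln_gt0 // ltr1n.
have nX : nm X * (nm alpha + 1) < 1.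
  rewrite normc_cpow // /powR gt_eqF // -[nm alpha + 1]lnK; last first.
    by rewrite posrE ltr_pwDr.
  rewrite -expRD -[X in _ < X]expR0 ltr_expR.
  move: hs; rewrite ltr_pdivrMr ?mulr_gt0 //.
  have -> : complex.Re (- (2 * s)) = - (2 * complex.Re s).
    have -> : - (2 * s) = - s - s by ring.
    by rewrite raddfB raddfN /=; ring.
  by set A := ln (nm _ + 1); set B := ln _; lra.
pose z := alpha * X; have z1 : nm z < 1.
  rewrite Normc.normcM mulrC; apply: le_lt_trans nX.
  by rewrite ler_wpM2l // lerDl.
have zn1 : z != 1 by apply/eqP => e; move: z1; rewrite e Normc.normc1 ltxx.
have hQ : (1 - alpha *: 'X).[X] = 1 - z.
  by rewrite hornerD hornerN hornerZ hornerX hornerC.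
have z10 : 1 - z != 0 by rewrite subr_eq0 eq_sym.
pose d := (alpha - 1) * c 0%N * X.
have cE i : c i * (q%:R ^+ 2 * X) ^+ i = term (c 0%N) d z i.
  case: i => [|i] /=; first by rewrite mulr1.
  elim: i => [|i IH].
    by rewrite expr1 expr0 mulr1 /d -c1; ring.
  rewrite [in RHS]exprS [d * _]mulrCA -IH /z.
  have -> : forall P : C, alpha * X * (c i.+1 * P) = alpha * c i.+1 * (X * P).
    by move=> P; ring.
  by rewrite -cS [_ ^+ i.+2]exprS; ring.
have fneg a : ordv (val a) < 0 -> integrand a = 0.
  by move=> a0; rewrite /integrand Wneg // mul0r.
have fE (i : nat) a : ordv (val a) = i -> integrand a = term (c 0%N) d z i.
  by move=> oa; rewrite -cE /integrand (Wc i) // (norm_val_cpow _ oa).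
have [M [rho [rho1 hM]]] := term_bound (c 0%N) d z1.
have part (p : {additive C -> R}) : (forall t, `|p t| <= nm t) ->
    nu.-integrable setT (fun a : borel (units E) => (p (integrand a))%:E) /\
    Rintegral nu setT (fun a : borel (units E) => p (integrand a)) =
      p (c 0%N + d / (1 - z)).
  move=> hp; apply: (shell_integral hnu hnu1 (h := fun i => p (term (c 0%N) d z i))
    (C := M) (rho := rho)) => //.
  - by move=> a a0; rewrite fneg // raddf0.
  - by move=> i a oa; rewrite (fE i).
  - by move=> i; apply: le_trans (hM i).
  - exact: term_cvg.
have [iRe vRe] := part (@complex.Re R) Re_le_normc.
have [iIm vIm] := part (@complex.Im R) Im_le_normc.
split; [by split|by rewrite hQ|].
rewrite /complex_integral vRe vIm hQ !hornerE.
transitivity (c 0%N + d / (1 - z)); first by case: (c 0%N + _).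
by rewrite /d /z; field.
Qed.

End ZetaIntegral.

(** * The formula for the zeta integral *)

Theorem proposition4p12 (R : realType)
    (F : localFieldType) (hF0 : [pchar F] =i pred0)
    (p : nat) (hp : residue_char F p) (hp_odd : odd p)
    (E : localFieldExtType F) (hE : unramified_quadratic E)
    (bar : {lrmorphism E -> E}) (hbar : exists x, bar x != x)
    (varpi : F) (hvarpi : uniformizer varpi)
    (zeta : U3 bar)
    (hzeta : val zeta = mx3 varpi%:A 0 0
                            0        1 0
                            0        0 (varpi%:A)^-1)
    (psi : E -> R[i]) (hpsi : additive_char_conductor0 psi)
    (mu : {measure set (borel (U3 bar)) -> \bar R})
    (hmu : left_haar (fun g h : U3 bar => (g * h)%g) mu)
    (nu : {measure set (borel (units E)) -> \bar R})
    (hnu : left_haar (fun a b : units E => (a * b)%g) nu)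
    (hnu1 : nu [set a : units E | ordv (val a) = 0] = 1%E)
    (V : lmodType R[i]) (pi : representation (U3 bar) V)
    (hsmooth : smooth_rep pi) (hirr : irreducible_rep pi)
    (l : {scalar V}) (hl : whittaker_functional pi psi l)
    (hl0 : exists v, l v != 0)
    (omega : E -> R[i]) (homega : central_char pi omega)
    (N n_pi : nat) (hN : conductor pi N)
    (hn_pi : central_conductor bar omega n_pi)
    (hN2 : (2 <= N)%N) (hNn : (n_pi < N)%N)
    (lambda : R[i])
    (hlambda : forall v, fixed_by pi (Kn bar N) v ->
       hecke_op pi mu zeta N v = lambda *: v)
    (v : V) (hv : fixed_by pi (Kn bar N) v) :
  let q := residue_card F in
  is_zeta_integral nu q (whittaker_fun pi l v)
    ((1 - 'X)%:F / (1 - ((lambda + q%:R ^+ 2) / q%:R ^+ 2) *: 'X)%:F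
     * ((whittaker_fun pi l v 1%g)%:P)%:F).
Proof.
move=> q.
have two := ounit_two hp hp_odd.
have twoE := ounit_nat_alg hE two.
have [barK barI [delta du bd] fixed_reps] := unramified_quadraticP hE hbar two.
have [uw bw] := uniformizer_alg hE bar hvarpi.
have [r hr] := residue_reps E.
have [I2 [s2 [card2 hs2]]] := fixed_reps 2%N.
have [I1 [s1 [_ hs1]]] := fixed_reps 1%N.
have [I0 [s0 [card0 hs0]]] := fixed_reps 0%N.
case: N hN hN2 hNn hlambda hv => [//|m] hNm m1 nm hlam hvm.
have noK u : fixed_by pi (Kn bar m) u -> u = 0.
  move=> hu; apply/eqP; apply: contraT => u0; have [_ hmin] := hNm.
  by have := hmin m (ex_intro2 _ _ u hu u0); rewrite ltnn.
have hz z u : z * bar z = 1 -> frac_ideal m%:Z (z - 1) ->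
    pi (scalarg bar z) u = u.
  move=> zz z1; rewrite (homega _ z) ?val_scalarg //.
  have [hn _] := hn_pi; rewrite hn ?scale1r //.
  by split=> // _; apply: idealW z1; lia.
have [muf mu0 muK] := haar_Kn barI hmu m.+1.
have hT := hecke_op_cells barK barI twoE uw bw du bd hzeta hr hs2 hs1 m1 hvm
  muf mu0 (fun g => measurable_translate_Kn m.+1 g) muK.
rewrite hlam // in hT.
have [c [c0 cE c1 cS]] := whittaker_recurrence barK barI twoE uw bw du bd hpsi
  hl hzeta hvm hr hs2 hs1 hs0 m1 noK hz (esym hT).
have -> : whittaker_fun pi l v 1%g = c 0%N by rewrite /whittaker_fun raction1 c0.
have qE : residue_card E = (q ^ 2)%N by have [_ _ ->] := hE.
have q0 : (q%:R : R[i]) != 0.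
  by rewrite pnatr_eq0; have := residue_card_gt1 F; rewrite -/q; lia.
rewrite !card_ord qE card0 card2 -/q expn0 muln1 natrM natrX in c1 cS.
apply: (is_zeta_integral_geometric hnu hnu1 (residue_card_gt1 F) qE) => //.
- by move=> a a0; apply: (whittaker_neg barK barI twoE du bd hpsi hl hvm).
- apply: (mulfI (expf_neq0 2 q0)); rewrite mulrA -c1.
  by field.
- move=> i; apply: (mulfI (expf_neq0 2 q0)).
  rewrite mulrA; move/eqP: (cS i); rewrite eq_sym subr_eq => /eqP ->.
  by field.
Qed.
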